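(* Let $\boldsymbol\mu=\{\mu_\beta\}_{|\beta|\ge1}$ be a weight sequence such that $\mathcal D(\boldsymbol\mu)$ contains a neighborhood of the origin. The Hardy algebra $F_s^\infty(\boldsymbol\mu)$ can be identified with the multiplier algebra $\mathcal M(\mathbb H^2(\mathcal D(\boldsymbol\mu)))$; that is, $A\mapsto UAU^*$ maps $F_s^\infty(\boldsymbol\mu)$ onto the algebra $\{M_\varphi:\varphi\in\mathcal M(\mathbb H^2(\mathcal D(\boldsymbol\mu)))\}$, where $U:F_s^2(\boldsymbol\mu)\to\mathbb H^2(\mathcal D(\boldsymbol\mu))$ is the unitary operator with $U(y^{(\mathbf k)})=\lambda^{\mathbf k}$. Moreover, each $\varphi(B)\in F_s^\infty(\boldsymbol\mu)$ has a unique Fourier representation $\sum_{\mathbf k\in\mathbb N_0^n}c_{\mathbf k}B^{\mathbf k}$ and $$\varphi(B)=\text{SOT-}\lim_{N\to\infty}\sum_{\mathbf k\in\mathbb N_0^n,\,|\mathbf k|\le N}\Big(1-\frac{|\mathbf k|}{N+1}\Big)c_{\mathbf k}B^{\mathbf k}.$$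
   Context: $\mathbb F_n^+$ is the unital free semigroup on generators $g_1,\ldots,g_n$ with identity $g_0$. $F^2(H_n)$ is the full Fock space, a Hilbert space with orthonormal basis $\{e_\alpha\}_{\alpha\in\mathbb F_n^+}$, $1:=e_{g_0}$. For $\alpha=g_{i_1}\cdots g_{i_k}$: $\lambda_\alpha:=\lambda_{i_1}\cdots\lambda_{i_k}$, $\boldsymbol\mu(\alpha,g_0):=\mu_{g_{i_1}\cdots g_{i_k}}\mu_{g_{i_2}\cdots g_{i_k}}\cdots\mu_{g_{i_k}}$; for $g_0$ both are $1$. Standing assumptions: $\mu_\beta>0$, and for each $i$, $\sup_\alpha\mu_{g_i\alpha}<\infty$ and $\sup_\alpha\boldsymbol\mu(\alpha g_i,g_0)/\boldsymbol\mu(\alpha,g_0)<\infty$. The weighted left multi-shift is $W_ie_\alpha:=\mu_{g_i\alpha}e_{g_i\alpha}$. $\mathcal D(\boldsymbol\mu):=\{\lambda\in\mathbb C^n:\sum_\alpha|\lambda_\alpha|^2/\boldsymbol\mu(\alpha,g_0)^2<\infty\}$. For $\mathbf k\in\mathbb N_0^n$, $|\mathbf k|:=k_1+\cdots+k_n$, $\lambda^{\mathbf k}:=\lambda_1^{k_1}\cdots\lambda_n^{k_n}$, $\Lambda_{\mathbf k}:=\{\alpha:\lambda_\alpha=\lambda^{\mathbf k}\ \forall\lambda\in\mathbb C^n\}$, $\omega_{\mathbf k}:=\sum_{\alpha\in\Lambda_{\mathbf k}}\boldsymbol\mu(\alpha,g_0)^{-2}$, $y^{(\mathbf k)}:=\frac1{\omega_{\mathbf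 k}}\sum_{\alpha\in\Lambda_{\mathbf k}}\frac1{\boldsymbol\mu(\alpha,g_0)}e_\alpha$ (orthogonal, $\|y^{(\mathbf k)}\|=\omega_{\mathbf k}^{-1/2}$). $F_s^2(\boldsymbol\mu)$ is the closed span of the $y^{(\mathbf k)}$; $B_i:=P_{F_s^2(\boldsymbol\mu)}W_i|_{F_s^2(\boldsymbol\mu)}$ (commuting operators), $B^{\mathbf k}:=B_1^{k_1}\cdots B_n^{k_n}$. $F_s^\infty(\boldsymbol\mu)$ is the $w^*$-closed non-self-adjoint algebra generated by $B_1,\ldots,B_n$ and the identity. $\mathbb H^2(\mathcal D(\boldsymbol\mu))$ is the Hilbert space of functions $\varphi(\lambda)=\sum_{\mathbf k}c_{\mathbf k}\lambda^{\mathbf k}$ on $\mathcal D(\boldsymbol\mu)$ with $\|\varphi\|^2=\sum_{\mathbf k}|c_{\mathbf k}|^2/\omega_{\mathbf k}<\infty$; $\mathcal M(\mathbb H^2(\mathcal D(\boldsymbol\mu)))$ is the set of functions $\varphi$ on $\mathcal D(\boldsymbol\mu)$ with $\varphi f\in\mathbb H^2(\mathcal D(\boldsymbol\mu))$ for all $f\in\mathbb H^2(\mathcal D(\boldsymbol\mu))$, and $M_\varphi f:=\varphi f$. If $A\in F_s^\infty(\boldsymbol\mu)$ and $A1=\sum_{\mathbf k}c_{\mathbf k}y^{(\mathbf k)}$, the formal series $\sum_{\mathbf k}c_{\mathbf k}B^{\mathbf k}$ is the Fourier representation of $A$; it satisfies $\sum_{\mathbf k}c_{\mathbf k}B^{\mathbf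 k}y^{(\mathbf p)}=Ay^{(\mathbf p)}$ for all $\mathbf p\in\mathbb N_0^n$. *)

(* Defs.v *)
From HB Require Import structures.
From mathcomp Require Import all_boot all_order all_algebra finmap complex.
From mathcomp Require Import all_classical all_reals all_analysis.
From mathcomp Require Import ring lra.
From mathcomp.analysis.showcase Require Import summability.
Import Order.TTheory GRing.Theory Num.Theory numFieldNormedType.Exports Normc.

Set Implicit Arguments.
Unset Strict Implicit.
Unset Printing Implicit Defensive.

Local Open Scope classical_set_scope.
Local Open Scope complex_scope.
Local Open Scope ring_scope.

#[export] Existing Instance totally_filter.

Section unordered_sums.
Variables (R : realType) (I : choiceType).
Implicit Types (f : I -> R[i]) (s : R[i]).

(* Sums over an arbitrary index type are unordered: limits of the finite
   partial sums along the directed set of finite subsets. *)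
Definition has_csum f s := partial_sum f @ totally --> (s : R[i]^o).

Definition csum f : R[i] := lim (partial_sum f @ totally : set_system R[i]^o).

Lemma partial_sumE (V : zmodType) (g : I -> V) (J : {fset I}) :
  partial_sum g J = \sum_(i <- J) g i.
Proof. by rewrite /partial_sum big_seq_fsetE. Qed.

Lemma has_csum_unique f s : has_csum f s -> csum f = s.
Proof.
move=> fs; rewrite /csum.
exact: (@cvg_lim R[i]^o (@norm_hausdorff _ R[i]^o) _ _ _ _ _ fs).
Qed.

Lemma has_csum_lin a f g s t : has_csum f s -> has_csum g t ->
  has_csum (fun i => a * f i + g i) (a * s + t).
Proof.
move=> fs gt; rewrite /has_csum.
have -> : partial_sum (fun i => a * f i + g i) =
    (fun J => a * partial_sum f J + partial_sum g J).
  by apply/funext => J; rewrite !partial_sumE big_split/= mulr_sumr.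
have afs : (fun J => a *: (partial_sum f J : R[i]^o)) @ totally --> (a *: (s : R[i]^o)).
  exact: cvgZr.
exact: (@cvgD _ (R[i]^o) _ _ _ _ _ _ _ afs gt).
Qed.

Lemma has_csum0 : has_csum (fun=> 0) 0.
Proof.
rewrite /has_csum; have -> : partial_sum (fun=> 0) = (fun=> 0) :> ({fset I} -> R[i]).
  by apply/funext => J; rewrite partial_sumE big1.
exact: (@cvg_cst R[i]^o).
Qed.

Lemma has_csum_delta (k : I) (a : R[i]) :
  has_csum (fun i => if i == k then a else 0) a.
Proof.
apply/(@cvgrPdist_lt _ R[i]^o) => /= e e0; exists [fset k]%fset => // J /= kJ.
rewrite partial_sumE (big_fsetD1 k)/=; last first.
  by rewrite (fsubsetP kJ)// inE.
rewrite eqxx big_seq_cond big1 ?addr0 ?subrr ?normr0// => i.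
by rewrite !inE => /andP[/andP[/negbTE ->]].
Qed.

Lemma partial_sum_esum (f : I -> R) : (forall i, 0 <= f i) ->
  (\esum_(i in setT) (f i)%:E < +oo)%E ->
  partial_sum f @ totally --> fine (\esum_(i in setT) (f i)%:E)%E.
Proof.
move=> f0 foo.
have pe (J : {fset I}) : ((partial_sum f J)%:E = \sum_(i \in [set` J]) (f i)%:E)%E.
  by rewrite fsbig_finite//= set_fsetK partial_sumE sumEFin.
have leE (J : {fset I}) : ((partial_sum f J)%:E <= \esum_(i in setT) (f i)%:E)%E.
  by rewrite pe; apply: ereal_sup_ubound; exists [set` J].
have sfin : (\esum_(i in setT) (f i)%:E)%E \is a fin_num.
  by rewrite ge0_fin_numE// esum_ge0// => i _; rewrite lee_fin.
set s := fine _; have sE : (\esum_(i in setT) (f i)%:E = s%:E)%E by rewrite fineK.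
apply/cvgrPdist_lt => e e0.
have : ((s - e)%:E < \esum_(i in setT) (f i)%:E)%E.
  by rewrite sE lte_fin ltrBlDr ltrDl.
move=> /ereal_sup_gt[_ [A [finA _] <-] lA].
exists (fset_set A) => // J /= AJ.
have : ((s - e)%:E < (partial_sum f J)%:E)%E.
  apply: (lt_le_trans lA); rewrite pe.
  rewrite [leLHS]fsbig_finite//= [leRHS]fsbig_finite//= set_fsetK !sumEFin lee_fin.
  rewrite [leRHS](big_fsetID _ (mem (fset_set A)))/=.
  have -> : [fset x in J | x \in fset_set A]%fset = fset_set A.
    apply/fsetP => i; rewrite !inE/= andbC.
    by case: (boolP (i \in fset_set A)) => // /(fsubsetP AJ).
  by rewrite lerDl sumr_ge0.
rewrite lte_fin => h; have := leE J; rewrite sE lee_fin => h'.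
by rewrite ger0_norm ?subr_ge0// ltrBlDl -ltrBlDr.
Qed.

Lemma has_csum_real (f : I -> R) (s : R) : partial_sum f @ totally --> s ->
  has_csum (fun i => (f i)%:C) s%:C.
Proof.
move=> /cvgrPdist_lt fs; apply/(@cvgrPdist_lt _ R[i]^o) => /= e e0.
have eE : e = (complex.Re e)%:C by rewrite RRe_real// gtr0_real.
have Re0 : 0 < complex.Re e by rewrite eE ltcR in e0.
have := fs _ Re0; apply: filterS => J.
rewrite !partial_sumE -rmorph_sum -rmorphB/= => h.
by rewrite normc_def/= expr0n/= addr0 sqrtr_sqr eE ltcR.
Qed.

End unordered_sums.

Section l2_space.
Variables (R : realType) (I : choiceType).
Implicit Types (w : I -> R) (x y : I -> R[i]).

(* The squared norm of x in the weighted l2 space. *)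
Definition l2_mass w x : \bar R := (\esum_(i in setT) (w i * normc (x i) ^+ 2)%R%:E)%E.

Lemma l2_mass0 w : l2_mass w 0 = 0%E.
Proof. by apply: esum1 => i _; rewrite normc0 expr0n/= mulr0. Qed.

Lemma l2_mass_ge0 w x : (forall i, 0 <= w i) -> (0 <= l2_mass w x)%E.
Proof. by move=> w0; apply: esum_ge0 => i _; rewrite lee_fin mulr_ge0// sqr_ge0. Qed.

Lemma l2_mass_comb w (a : R[i]) x y : (forall i, 0 <= w i) ->
  (l2_mass w (a *: x + y)%R <=
   (2 * normc a ^+ 2)%R%:E * l2_mass w x + 2%:E * l2_mass w y)%E.
Proof.
move=> w0.
have esumZ (c : R) z : 0 <= c -> (\esum_(i in setT) (c * (w i * normc (z i) ^+ 2))%R%:E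
    <= c%:E * l2_mass w z)%E.
  move=> c0; apply: ge_ereal_sup => _ [X [finX _] <-].
  rewrite (eq_fsbigr (fun i => c%:E * (w i * normc (z i) ^+ 2)%R%:E)%E); last first.
    by move=> i _; rewrite EFinM.
  rewrite -ge0_mule_fsumr; last by move=> i; rewrite lee_fin mulr_ge0// sqr_ge0.
  by apply: lee_wpmul2l; rewrite ?lee_fin//; apply: ereal_sup_ubound; exists X.
apply: le_trans (leeD (esumZ (2 * normc a ^+ 2) x _) (esumZ 2 y _)) => //; last first.
  by rewrite mulr_ge0// sqr_ge0.
have t0 (c : R) z (i : I) : 0 <= c -> (0 <= (c * (w i * normc (z i) ^+ 2))%R%:E)%E.
  by move=> c0; rewrite lee_fin mulr_ge0// mulr_ge0// sqr_ge0.
have a0 : 0 <= 2 * normc a ^+ 2 by rewrite mulr_ge0// sqr_ge0.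
rewrite -esumD => [|i _|i _]; [|exact: t0..].
apply: le_esum => i _; rewrite -EFinD lee_fin.
rewrite [leRHS](_ : _ = w i * (2 * (normc a * normc (x i)) ^+ 2 + 2 * normc (y i) ^+ 2)); last first.
  by ring.
rewrite ler_wpM2l// -normcM.
set p := a * x i; set q := y i.
rewrite [X in normc X](_ : _ = p + q)//.
apply: (@le_trans _ _ ((normc p + normc q) ^+ 2)).
  have n0 (z : R[i]) : 0 <= normc z by case: z => u v; exact: sqrtr_ge0.
  by rewrite ler_sqr ?nnegrE ?addr_ge0 ?n0//; exact: le_normcD.
have := sqr_ge0 (normc p - normc q).
by move: (normc p) (normc q) => P Q; nra.
Qed.

Lemma l2_mass_delta w (k : I) : 0 <= w k ->
  l2_mass w (fun i => (i == k)%:R) = (w k)%:E.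
Proof.
move=> wk0; rewrite -(@esum_set1 R I k (fun i => (w i)%:E)) ?lee_fin//.
rewrite [RHS]esum_mkcond; apply: eq_esum => i _.
have -> : (i \in [set k]) = (i == k) by apply/idP/eqP; rewrite inE.
have [->|_] := eqVneq i k.
  by rewrite mulr1n normc1 expr1n mulr1.
by rewrite mulr0n normc0 expr0n/= mulr0.
Qed.

Definition l2_set : set (I -> R[i]) := [set x | (l2_mass (fun=> 1%R) x < +oo)%E].

Definition l2_pred : {pred I -> R[i]} := mem l2_set.

Lemma l2_submod_closed : submod_closed l2_pred.
Proof.
split=> [|a x y]; first by rewrite inE /l2_set/= l2_mass0.
rewrite !inE /l2_set/= => xoo yoo.
have le01 : forall i : I, 0 <= (1 : R) by [].
apply: (le_lt_trans (l2_mass_comb a x y le01)).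
have fin0 z : (l2_mass (fun=> 1%R) z < +oo)%E -> l2_mass (fun=> 1%R) z \is a fin_num.
  by move=> ?; rewrite ge0_fin_numE// l2_mass_ge0.
rewrite -(fineK (fin0 _ xoo)) -(fineK (fin0 _ yoo)) -!EFinM -EFinD.
exact: ltry.
Qed.

HB.instance Definition _ :=
  GRing.isSubmodClosed.Build R[i] (I -> R[i]) l2_pred l2_submod_closed.

Record l2 : Type := L2 { l2_fun :> I -> R[i] ; l2_funP : l2_fun \in l2_pred }.

HB.instance Definition _ := [isSub for l2_fun].
HB.instance Definition _ := [Choice of l2 by <:].
HB.instance Definition _ := [SubChoice_isSubLmodule of l2 by <:].

Lemma l2_basisP (k : I) : (fun i => (i == k)%:R : R[i]) \in l2_pred.
Proof. by rewrite inE /l2_set/= l2_mass_delta ?ltry. Qed.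

Definition l2_basis (k : I) : l2 := L2 (l2_basisP k).

Definition l2_dot (x y : l2) : R[i] := csum (fun i => x i * (y i)^*).

End l2_space.

Section inner_product_notions.
Variables (R : realType) (V : lmodType R[i]) (dot : V -> V -> R[i]).
Implicit Types (T : V -> V) (G S : set (V -> V)).

Definition hnorm (v : V) : R := Num.sqrt (complex.Re (dot v v)).

Definition has_hsum (J : choiceType) (f : J -> V) (v : V) :=
  (fun F => hnorm (partial_sum f F - v)) @ totally --> (0 : R).

Definition lin_span (J : Type) (f : J -> V) : set V :=
  [set v | exists s : seq (R[i] * J), v = \sum_(p <- s) p.1 *: f p.2].

Definition hclosure (A : set V) : set V :=
  [set v | forall e : R, 0 < e -> exists2 u, A u & hnorm (v - u) < e].

Definition bounded_op T :=
  linear T /\ exists M : R, forall v, hnorm (T v) <= M * hnorm v.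

Definition sot_cvg (T_ : nat -> V -> V) T :=
  forall v, (fun N => hnorm (T_ N v - T v)) @ \oo --> (0 : R).

Definition square_summable (xi : nat -> V) :=
  (\esum_(j in setT) (hnorm (xi j) ^+ 2)%:E < +oo)%E.

(* The w*-topology of B(V), V a Hilbert space, is the weakest one that makes
   the functionals T |-> sum_j <T xi_j, eta_j> continuous, for all square
   summable sequences xi and eta. *)
Definition trace_functional (xi eta : nat -> V) T : R[i] :=
  csum (fun j => dot (T (xi j)) (eta j)).

Definition wstar_adherent S T :=
  forall (m : nat) (xi eta : 'I_m -> nat -> V) (e : R),
    (forall l, square_summable (xi l)) -> (forall l, square_summable (eta l)) ->
    0 < e ->
    exists2 A, S A &
      forall l, normc (trace_functional (xi l) (eta l) (A \- T)) < e.

Definition wstar_closed S := forall T, bounded_op T -> wstar_adherent S T -> S T.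

Definition op_algebra S :=
  [/\ S `<=` bounded_op,
      forall (a : R[i]) A B, S A -> S B -> S (fun v => a *: A v + B v) &
      forall A B, S A -> S B -> S (A \o B)].

Definition wstar_algebra G : set (V -> V) :=
  [set T | forall S, op_algebra S -> wstar_closed S -> G `<=` S -> S T].

Lemma lin_span_comb (J : Type) (f : J -> V) (a : R[i]) u v :
  lin_span f u -> lin_span f v -> lin_span f (a *: u + v).
Proof.
move=> [s ->] [t ->]; exists ([seq (a * p.1, p.2) | p <- s] ++ t).
rewrite big_cat big_map/= scaler_sumr; congr (_ + _).
by apply: eq_bigr => p _; rewrite scalerA.
Qed.

End inner_product_notions.

Section unitary.
Variables (R : realType) (V W : lmodType R[i]).
Variables (dotV : V -> V -> R[i]) (dotW : W -> W -> R[i]).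

Definition unitary (U : V -> W) (Uadj : W -> V) :=
  [/\ linear U, forall v w, dotW (U v) w = dotV v (Uadj w),
      cancel U Uadj & cancel Uadj U].

End unitary.

Section l2_norm.
Variables (R : realType) (I : choiceType).
Local Notation H := (l2 R I).
Local Notation l2_norm := (hnorm (@l2_dot R I)).

Lemma l2_dotxx (x : H) : l2_dot x x = (fine (l2_mass (fun=> 1) x))%:C.
Proof.
apply: has_csum_unique.
have -> : (fun i => x i * (x i)^*) = (fun i => (1 * normc (x i) ^+ 2)%:C).
  apply/funext => i; rewrite mul1r; case: (x i) => a b /=.
  rewrite sqr_sqrtr ?addr_ge0 ?sqr_ge0//; simpc.
  by rewrite (mulrC b a) addNr -!expr2.
apply: has_csum_real; apply: partial_sum_esum => [i|]; first by rewrite mul1r sqr_ge0.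
by have := l2_funP x; rewrite inE.
Qed.

Lemma hnorm_sqr (x : H) : (l2_norm x ^+ 2)%:E = l2_mass (fun=> 1) x.
Proof.
have x0 : (0 <= l2_mass (fun=> 1%R) x)%E by exact: l2_mass_ge0.
rewrite /hnorm l2_dotxx sqr_sqrtr ?fine_ge0// fineK//.
by rewrite ge0_fin_numE//; have := l2_funP x; rewrite inE.
Qed.

Lemma hclosure_comb (A : set H) (a : R[i]) :
  (forall u v, A u -> A v -> A (a *: u + v)) ->
  forall u v, hclosure (@l2_dot R I) A u -> hclosure (@l2_dot R I) A v ->
  hclosure (@l2_dot R I) A (a *: u + v).
Proof.
move=> Acomb u v cu cv e e0.
have n0 (z : R[i]) : 0 <= normc z by case: z => p q; exact: sqrtr_ge0.
pose d := e / (2 * (normc a + 1)).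
have d0 : 0 < d by rewrite divr_gt0 ?mulr_gt0 ?ltr_wpDl.
have [u' Au' uu'] := cu _ d0.
have [v' Av' vv'] := cv (e / 2) (divr_gt0 e0 (@ltr0Sn R 1)).
exists (a *: u' + v'); first exact: Acomb.
have h0 x : 0 <= l2_norm x by exact: sqrtr_ge0.
rewrite -(@ltr_pXn2r _ 2)// ?nnegrE// ?ltW// -lte_fin hnorm_sqr.
have -> : a *: u + v - (a *: u' + v') = a *: (u - u') + (v - v').
  by rewrite scalerBr opprD addrACA.
have := @l2_mass_comb R I (fun=> 1) a (u - u') (v - v') (fun=> ler01).
move=> /le_lt_trans; apply.
rewrite -!hnorm_sqr -!EFinM -EFinD lte_fin.
have : normc a * l2_norm (u - u') <= e / 2.
  apply: (@le_trans _ _ ((normc a + 1) * d)).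
    by apply: ler_pM => //; rewrite ?ltW// ltrDl.
  rewrite /d [leLHS](_ : _ = e / 2)//; field.
  by rewrite gt_eqF// ltr_wpDl.
move: (h0 (u - u')) (h0 (v - v')) vv' (n0 a) e0.
move: (l2_norm (u - u')) (l2_norm (v - v')) (normc a) => p q r p0 q0 qe r0 e0 rpe.
have : (r * p) * (r * p) <= (e / 2) * (e / 2) by rewrite ler_pM// mulr_ge0.
have : q * q < (e / 2) * (e / 2) by rewrite ltr_pM.
by nra.
Qed.

End l2_norm.

Definition word (n : nat) : choiceType := seq 'I_n.

Definition multiindex (n : nat) : choiceType := {ffun 'I_n -> nat}.

Definition mdegree n (k : multiindex n) : nat := (\sum_(i < n) k i)%N.

(* For a = g_(i_1) .. g_(i_k), the product of the weights of all nonempty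
   suffixes of a. *)
Fixpoint suffix_prod (R : realType) n (mu : word n -> R) (a : word n) : R :=
  if a is _ :: b then mu a * suffix_prod mu b else 1.

(* The value of a weight sequence at the empty word is never used. *)
Record weights (R : realType) (n : nat) := Weights {
  weight :> word n -> R ;
  weight_gt0 : forall b, b != [::] -> 0 < weight b ;
  weight_left_bounded : forall i, exists M : R, forall a, weight (i :: a) <= M ;
  weight_right_bounded : forall i, exists M : R, forall a,
    suffix_prod weight (rcons a i) / suffix_prod weight a <= M }.

Section symmetric_weighted_Fock_space.
Variables (R : realType) (n : nat) (mu : weights R n).
Local Notation C := R[i].
Local Notation word := (word n).
Local Notation multiindex := (multiindex n).
Local Notation Fock := (l2 R word).
Local Notation point := 'rV[R[i]^o]_n.

Definition word_monomial (l : point) (a : word) : C := \prod_(i <- a) l ord0 i.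

Definition monomial (l : point) (k : multiindex) : C :=
  \prod_(i < n) l ord0 i ^+ k i.

Definition Ddomain : set point := [set l |
  (\esum_(a in setT) (normc (word_monomial l a) ^+ 2 / suffix_prod mu a ^+ 2)%R%:E
     < +oo)%E].

Definition Lambda (k : multiindex) : set word :=
  [set a | forall l, word_monomial l a = monomial l k].

Definition omega (k : multiindex) : R :=
  \sum_(a \in Lambda k) (suffix_prod mu a ^+ 2)^-1.

(* On the basis vectors this is W_i e_a = mu_(g_i a) e_(g_i a), see shiftE. *)
Definition shift_fun (i : 'I_n) (x : word -> C) (a : word) : C :=
  if a is j :: b then if j == i then (mu a)%:C * x b else 0 else 0.

Lemma shift_funP i (x : Fock) : shift_fun i x \in @l2_pred R word.
Proof.
have := l2_funP x; rewrite !inE /l2_set/= => xoo.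
have [M muM] := weight_left_bounded mu i.
have M0 : 0 < M by apply: lt_le_trans (muM [::]); exact: weight_gt0.
have inj : set_inj setT (cons i : word -> word) by move=> a b _ _ [].
rewrite /l2_mass [X in (X < _)%E](_ : _ =
    \esum_(a in (cons i : word -> word) @` setT)
      (1 * normc (shift_fun i x a) ^+ 2)%:E)%E; last first.
  rewrite [RHS]esum_mkcond; apply: eq_esum => -[|j b] _.
    by case: ifP => // _; rewrite /shift_fun normc0 expr0n mulr0.
  case: ifPn => // /negP h; rewrite /shift_fun.
  case: eqP => [ji|_]; last by rewrite normc0 expr0n mulr0.
  by exfalso; apply: h; rewrite inE; exists b; rewrite ?ji.
rewrite esum_image//.
have : (M%:C *: (x : word -> C)) \in @l2_pred R word by rewrite rpredZ// l2_funP.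
rewrite inE; apply: le_lt_trans; apply: le_esum => b _.
rewrite /shift_fun eqxx lee_fin !mul1r.
have nC (r : R) : 0 <= r -> normc r%:C = r.
  by move=> r0; rewrite /normc/= expr0n/= addr0 sqrtr_sqr ger0_norm.
have n0 (z : C) : 0 <= normc z by case: z => p q; exact: sqrtr_ge0.
have mu0 : 0 < mu (i :: b) by exact: weight_gt0.
rewrite ler_sqr ?nnegrE ?n0//.
have -> : (M%:C *: (x : word -> C)) b = M%:C * x b by [].
by rewrite !normcM (nC _ (ltW mu0)) (nC _ (ltW M0)) ler_wpM2r.
Qed.

Definition shift (i : 'I_n) (x : Fock) : Fock := L2 (shift_funP i x).

Definition fock_basis (a : word) : Fock := l2_basis R a.

Lemma shiftE i a : shift i (fock_basis a) = (mu (i :: a))%:C *: fock_basis (i :: a).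
Proof.
apply/val_inj/funext => b /=; have [m mE] : exists m, mu (i :: a) = m by exists (mu (i :: a)).
rewrite mE.
transitivity (m%:C * (b == i :: a)%:R); last by [].
case: b => [|j b]; first by rewrite mulr0.
rewrite /shift_fun eqseq_cons; case: (eqVneq j i) => [->|_]; last by rewrite mulr0.
by have [->|_] := eqVneq b a; rewrite /= ?mulr0// mE.
Qed.

Definition y_vec (k : multiindex) : Fock :=
  ((omega k)^-1)%:C *: \sum_(a \in Lambda k) ((suffix_prod mu a)^-1)%:C *: fock_basis a.

Definition Fs2_set : set Fock := hclosure (@l2_dot R word) (lin_span y_vec).

Definition Fs2_pred : {pred Fock} := mem Fs2_set.

Lemma hclosure_sub (A : set Fock) : A `<=` hclosure (@l2_dot R word) A.
Proof.
move=> v Av e e0; exists v => //.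
suff -> : hnorm (@l2_dot R word) (v - v) = 0 by [].
apply/eqP; rewrite -sqrf_eq0 -eqe hnorm_sqr subrr.
by rewrite [X in l2_mass _ X](_ : _ = 0) ?l2_mass0.
Qed.

Lemma Fs2_submod_closed : submod_closed Fs2_pred.
Proof.
split=> [|a x y].
  by apply: mem_set; apply: hclosure_sub; exists [::]; rewrite big_nil.
move=> /set_mem cx /set_mem cy; apply: mem_set.
apply: (@hclosure_comb R word (lin_span y_vec) a _ x y cx cy) => u v.
exact: lin_span_comb.
Qed.

HB.instance Definition _ :=
  GRing.isSubmodClosed.Build C Fock Fs2_pred Fs2_submod_closed.

Record Fs2 : Type := SymFock { Fs2_val :> Fock ; Fs2_valP : Fs2_val \in Fs2_pred }.

HB.instance Definition _ := [isSub for Fs2_val].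
HB.instance Definition _ := [Choice of Fs2 by <:].
HB.instance Definition _ := [SubChoice_isSubLmodule of Fs2 by <:].

Definition Fs2_dot (x y : Fs2) : C := l2_dot x y.

Lemma y_vecP k : y_vec k \in Fs2_pred.
Proof.
apply: mem_set; apply: hclosure_sub; exists [:: (1, k)].
by rewrite big_seq1 scale1r.
Qed.

Definition Fs2_y (k : multiindex) : Fs2 := SymFock (y_vecP k).

Lemma Lambda0 : Lambda 0 = [set [::]].
Proof.
apply/seteqP; split=> [[//|i a] /(_ 0)|_ -> l].
  rewrite /word_monomial /monomial big_cons mxE mul0r big1 => [/esym/eqP|j _].
    by rewrite oner_eq0.
  by rewrite ffunE expr0.
by rewrite /word_monomial /monomial big_nil big1// => j _; rewrite ffunE expr0.
Qed.

Lemma y_vec0 : y_vec 0 = fock_basis [::].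
Proof.
by rewrite /y_vec /omega Lambda0 !fsbig_set1/= expr1n !invr1 !rmorph1 !scale1r.
Qed.

Lemma vacuumP : fock_basis [::] \in Fs2_pred.
Proof. by rewrite -y_vec0 y_vecP. Qed.

Definition vacuum : Fs2 := SymFock vacuumP.

(* The orthogonal projection of F^2(H_n) onto the closed subspace F_s^2(mu). *)
Definition Fs2_proj (x : Fock) : Fs2 :=
  xget 0 [set p : Fs2 | forall q : Fs2, l2_dot (x - p) q = 0].

Definition B_op (i : 'I_n) (x : Fs2) : Fs2 := Fs2_proj (shift i x).

Definition Bpow (k : multiindex) : Fs2 -> Fs2 :=
  \big[(fun S T => S \o T)/id]_(i < n) iter (k i) (B_op i).

Definition Fs_infty : set (Fs2 -> Fs2) :=
  wstar_algebra Fs2_dot (range B_op `|` [set id]).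

Definition fourier_rep (A : Fs2 -> Fs2) (c : multiindex -> C) :=
  has_hsum Fs2_dot (fun k => c k *: Fs2_y k) (A vacuum).

Definition cesaro_mean (c : multiindex -> C) (N : nat) (x : Fs2) : Fs2 :=
  \sum_(k \in [set k | (mdegree k <= N)%N])
     ((1 - (mdegree k)%:R / N.+1%:R) * c k) *: Bpow k x.

End symmetric_weighted_Fock_space.

Section Hardy_space.
Variables (R : realType) (n : nat) (mu : weights R n).
Local Notation C := R[i].
Local Notation multiindex := (multiindex n).
Local Notation D := (set_type (Ddomain mu)).
Local Notation wt := (fun k => (omega mu k)^-1).

Definition power_series (phi : D -> C) (c : multiindex -> C) :=
  (l2_mass wt c < +oo)%E /\
  forall l : D, has_csum (fun k => c k * monomial (val l) k) (phi l).

Definition H2_set : set (D -> C) := [set phi | exists c, power_series phi c].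

Definition H2_pred : {pred D -> C} := mem H2_set.

Lemma omega_ge0 k : 0 <= omega mu k.
Proof. by apply: fsumr_ge0 => a _; rewrite invr_ge0 sqr_ge0. Qed.

Lemma H2_submod_closed : submod_closed H2_pred.
Proof.
have w0 k : 0 <= wt k by rewrite invr_ge0 omega_ge0.
split=> [|a x y].
  apply: mem_set; exists 0; split=> [|l]; first by rewrite l2_mass0.
  rewrite [X in has_csum X](_ : _ = fun=> 0); first exact: has_csum0.
  by apply/funext => k; rewrite mul0r.
move=> /set_mem[c [coo cx]] /set_mem[d [doo dy]]; apply: mem_set; exists (a *: c + d); split=> [|l].
  apply: (le_lt_trans (l2_mass_comb a c d w0)).
  have fin0 z : (l2_mass wt z < +oo)%E -> l2_mass wt z \is a fin_num.
    by move=> ?; rewrite ge0_fin_numE// l2_mass_ge0.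
  by rewrite -(fineK (fin0 _ coo)) -(fineK (fin0 _ doo)) -!EFinM -EFinD ltry.
rewrite [X in has_csum X](_ : _ =
    fun k => a * (c k * monomial (val l) k) + d k * monomial (val l) k).
  exact: has_csum_lin (cx l) (dy l).
by apply/funext => k; rewrite mulrA -mulrDl.
Qed.

HB.instance Definition _ :=
  GRing.isSubmodClosed.Build C (D -> C) H2_pred H2_submod_closed.

Record H2 : Type := HardyFun { H2_fun :> D -> C ; H2_funP : H2_fun \in H2_pred }.

HB.instance Definition _ := [isSub for H2_fun].
HB.instance Definition _ := [Choice of H2 by <:].
HB.instance Definition _ := [SubChoice_isSubLmodule of H2 by <:].

(* The choice of the coefficients is immaterial when D(mu) contains a
   neighborhood of the origin, since they are then determined by phi. *)
Definition coefs (phi : H2) : multiindex -> C := xget 0 (power_series phi).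

Definition H2_dot (phi psi : H2) : C :=
  csum (fun k => coefs phi k * (coefs psi k)^* / (omega mu k)%:C).

Lemma monomialP (k : multiindex) : (fun l : D => monomial (val l) k) \in H2_pred.
Proof.
apply: mem_set; exists (fun j => (j == k)%:R); split=> [|l].
  by rewrite l2_mass_delta ?ltry ?invr_ge0 ?omega_ge0.
rewrite [X in has_csum X](_ : _ = fun j => if j == k then monomial (val l) k else 0).
  exact: has_csum_delta.
by apply/funext => j; case: eqP => [->|_]; rewrite ?mul1r ?mul0r.
Qed.

Definition H2_monomial (k : multiindex) : H2 := HardyFun (monomialP k).

Definition multiplier (phi : D -> C) := forall f : H2, phi \* f \in H2_pred.

Definition mult_op phi (phiM : multiplier phi) (f : H2) : H2 := HardyFun (phiM f).

End Hardy_space.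

Arguments Fs2_dot {R n} mu x y.
Arguments H2_dot {R n} mu phi psi.
Arguments Fs2_y {R n} mu k.
Arguments H2_monomial {R n} mu k.
Arguments B_op {R n} mu i x.
Arguments Bpow {R n} mu k x.
Arguments Fs_infty {R n} mu _.
Arguments fourier_rep {R n} mu A c.
Arguments cesaro_mean {R n} mu c N x.

(* Main.v *)
Require Import Defs.
From mathcomp Require Import all_boot all_order all_algebra finmap complex.
From mathcomp Require Import all_classical all_reals all_analysis.
From mathcomp Require Import ring lra zify.
From mathcomp.analysis.showcase Require Import summability.
Import Order.TTheory GRing.Theory Num.Theory numFieldNormedType.Exports Normc.

(* In the coordinates with respect to the vectors y^(k), each operator B_i is a
   shift of multi-indices, and evaluation at a point of D(mu) is the inner product
   with a vector of the full Fock space; so F_s^2(mu) is H^2(D(mu)), with B_i acting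
   as multiplication by the i-th variable.  Both sides of the theorem are identified
   with the commutant of the B_i.

   The commutant is a w*-closed algebra, hence contains F_s^infty(mu).  Conversely,
   the Cesaro means of an operator A of the commutant are averages of the compressions
   Q A Q to windows of consecutive degrees, so they are bounded by the norm of A;
   since they converge to A on each y^(k), they converge strongly, hence w*.

   Multiplication by phi commutes with the B_i, but its boundedness is not
   automatic.  Comparing the decay of phi f and f along curves t |-> (s t^(d_i))_i
   shows that it does not lower the order of vanishing at the origin; a gliding hump
   built from vectors that vanish to higher and higher order then excludes
   unboundedness. *)

Set Implicit Arguments.
Unset Strict Implicit.
Unset Printing Implicit Defensive.

Local Open Scope classical_set_scope.
Local Open Scope complex_scope.
Local Open Scope ring_scope.

(** The vectors [y^(k)] stay unnormalized: in their coordinates the weights disappear from [B_i] and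
    survive only in the norm, that of the l2 space with weights [1 / omega k]. Completeness of F_s^2
    enters through a single fact, that every coefficient family of finite mass comes from a vector;
    it yields the projections, the comparison vectors on a curve and the limit of the gliding hump.
    A fixed curve would not detect the order of vanishing: terms of least degree may cancel, as
    those of [l_1 - l_2] do on the diagonal. The exponents [d_i] are therefore fitted to the support
    of the function at hand, so that one monomial dominates. The same argument, for the zero
    function, shows that a function in H^2 determines its coefficients, on which its norm depends.
    Cesaro means replace partial sums because the latter need not be uniformly bounded, and the
    w*-functionals are controlled under a uniform bound. The windows take the place of integrating a
    Fejer kernel over the rotations of degree, and involve finite sums only. *)

(** * Modulus and conjugation of complex numbers *)

Section complex_modulus.
Variable R : realType.
Implicit Types (z u v : R[i]) (r : R).

Lemma normc_ge0 z : 0 <= normc z.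
Proof. by case: z => a b; exact: sqrtr_ge0. Qed.

Lemma norm_normc z : `|z| = (normc z)%:C.
Proof. by []. Qed.

Lemma normc_real r : 0 <= r -> normc r%:C = r.
Proof. by move=> r0; rewrite /normc/= expr0n/= addr0 sqrtr_sqr ger0_norm. Qed.

Lemma normc_conj z : normc (conjc z) = normc z.
Proof. by case: z => a b /=; rewrite sqrrN. Qed.

Lemma normcB u v : normc (u - v) = normc (v - u).
Proof. by rewrite -normcN opprB. Qed.

Lemma mul_conjc z : z * conjc z = (normc z ^+ 2)%:C.
Proof.
case: z => a b /=; rewrite sqr_sqrtr ?addr_ge0 ?sqr_ge0//; simpc.
by rewrite (mulrC b a) addNr -!expr2.
Qed.

Lemma real_complexM r t : (r * t)%:C = r%:C * t%:C :> R[i].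
Proof. exact: rmorphM. Qed.

Lemma real_complexD r t : (r + t)%:C = r%:C + t%:C :> R[i].
Proof. exact: rmorphD. Qed.

Lemma conjcB u v : conjc (u - v) = conjc u - conjc v.
Proof. exact: rmorphB. Qed.

Lemma conjcD u v : conjc (u + v) = conjc u + conjc v.
Proof. exact: rmorphD. Qed.

Lemma conjcM u v : conjc (u * v) = conjc u * conjc v.
Proof. exact: rmorphM. Qed.

Lemma normc_sum (I : Type) (s : seq I) (f : I -> R[i]) :
  normc (\sum_(i <- s) f i) <= \sum_(i <- s) normc (f i).
Proof.
elim/big_rec2: _ => [|i y x _ h]; first by rewrite normc0.
by apply: le_trans (le_normcD _ _) _; rewrite lerD2l.
Qed.

Lemma Re_le_normc z : complex.Re z <= normc z.
Proof.
case: z => a b /=; apply: le_trans (ler_norm _) _.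
by rewrite -sqrtr_sqr ler_wsqrtr// lerDl sqr_ge0.
Qed.

Lemma abs_Re_le_normc z : `|complex.Re z| <= normc z.
Proof. by case: z => a b /=; rewrite -sqrtr_sqr ler_wsqrtr// lerDl sqr_ge0. Qed.

Lemma abs_Im_le_normc z : `|complex.Im z| <= normc z.
Proof. by case: z => a b /=; rewrite -sqrtr_sqr ler_wsqrtr// lerDr sqr_ge0. Qed.

End complex_modulus.

(** * Unordered sums of complex numbers *)

Section complex_sums.
Variables (R : realType) (I : choiceType).
Implicit Types (f g : I -> R[i]) (s t : R[i]).

Lemma has_csumP f s : has_csum f s <-> forall e : R, 0 < e ->
  exists J0 : {fset I}, forall J : {fset I}, (J0 `<=` J)%fset ->
    normc (s - \sum_(i <- J) f i) < e.
Proof.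
split=> [/(@cvgrPdist_lt _ R[i]^o) fs e e0|fs].
  have e0' : (0 : R[i]) < e%:C by rewrite ltcR.
  have [J0 _ h] := fs _ e0'; exists J0 => J /h /=.
  by rewrite partial_sumE norm_normc ltcR.
apply/(@cvgrPdist_lt _ R[i]^o) => /= e e0.
have eE : e = (complex.Re e)%:C by rewrite RRe_real// gtr0_real.
have [|J0 h] := fs (complex.Re e); first by rewrite eE ltcR in e0.
exists J0 => // J /h; rewrite /= partial_sumE norm_normc => h'.
by rewrite eE ltcR.
Qed.

Lemma has_csum_inj f s t : has_csum f s -> has_csum f t -> s = t.
Proof. by move=> /has_csum_unique <- /has_csum_unique <-. Qed.

Lemma has_csumZ a f s : has_csum f s -> has_csum (fun i => a * f i) (a * s).
Proof.
move=> fs; have := has_csum_lin (a := a) fs (@has_csum0 R I).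
by rewrite addr0; congr has_csum; apply/funext => i; rewrite addr0.
Qed.

Lemma has_csumD f g s t : has_csum f s -> has_csum g t ->
  has_csum (fun i => f i + g i) (s + t).
Proof.
move=> fs gt; have := has_csum_lin (a := 1) fs gt.
by rewrite mul1r; congr has_csum; apply/funext => i; rewrite mul1r.
Qed.

Lemma has_csum_conj f s : has_csum f s -> has_csum (fun i => conjc (f i)) (conjc s).
Proof.
move=> /has_csumP fs; apply/has_csumP => e /fs[J0 h]; exists J0 => J /h.
by rewrite -rmorph_sum -conjcB normc_conj.
Qed.

Lemma has_csum_le f s (M : R) :
  (forall J : {fset I}, normc (\sum_(i <- J) f i) <= M) -> has_csum f s -> normc s <= M.
Proof.
move=> fM /has_csumP fs; apply/ler_addgt0Pr => e /fs[J0 /(_ _ (fsubset_refl J0)) h].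
rewrite -[s](subrK (\sum_(i <- J0) f i)).
by apply: le_trans (le_normcD _ _) _; rewrite addrC lerD// ltW.
Qed.

(** Adding [g] makes the real and the imaginary part nonnegative; sums of nonnegative terms converge
    to their supremum, and the sum of [g] is subtracted again. *)
Lemma has_csum_dominated f (g : I -> R) : (forall i, normc (f i) <= g i) ->
  (\esum_(i in setT) (g i)%:E < +oo)%E -> exists s, has_csum f s.
Proof.
move=> fg goo.
have g0 i : 0 <= g i by apply: le_trans (fg i); exact: normc_ge0.
have gfin : (\esum_(i in setT) (g i)%:E)%E \is a fin_num.
  by rewrite ge0_fin_numE// esum_ge0// => i _; rewrite lee_fin.
have real_part (h : I -> R) : (forall i, `|h i| <= g i) ->
    exists s : R, has_csum (fun i => (h i)%:C) s%:C.
  move=> hg.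
  have hg0 i : 0 <= h i + g i by have := hg i; rewrite ler_norml; lra.
  have hgoo : (\esum_(i in setT) (h i + g i)%:E < +oo)%E.
    apply: (@le_lt_trans _ _ (\esum_(i in setT) ((g i)%:E + (g i)%:E))%E).
      apply: le_esum => i _; rewrite -EFinD lee_fin lerD2r.
      by have := hg i; rewrite ler_norml => /andP[].
    rewrite esumD; [|by move=> i _; rewrite lee_fin..].
    by rewrite -(fineK gfin) -EFinD ltry.
  have h1 := has_csum_real (partial_sum_esum hg0 hgoo).
  have h2 := has_csum_real (partial_sum_esum g0 goo).
  have := has_csum_lin (a := -1) h2 h1; rewrite mulN1r.
  set s1 := fine _; set s2 := fine _ => h3.
  exists (- s1 + s2); rewrite rmorphD rmorphN/=.
  move: h3; congr has_csum; apply/funext => i.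
  by rewrite rmorphD/= mulN1r addrCA addNr addr0.
have [a ha] := real_part (fun i => complex.Re (f i)) (fun i => le_trans (abs_Re_le_normc _) (fg i)).
have [b hb] := real_part (fun i => complex.Im (f i)) (fun i => le_trans (abs_Im_le_normc _) (fg i)).
exists ('i%C * b%:C + a%:C); have := has_csum_lin (a := 'i%C) hb ha.
congr has_csum; apply/funext => i; rewrite addrC; exact/esym/complexE.
Qed.

End complex_sums.

(** * Inner product spaces *)

(** Kept abstract because it is applied both to the full Fock space and to F_s^2. *)
Definition inner_product (R : realType) (V : lmodType R[i]) (dot : V -> V -> R[i]) :=
  [/\ forall a u v w, dot (a *: u + v) w = a * dot u w + dot v w,
      forall u v, dot v u = conjc (dot u v),
      forall u, 0 <= complex.Re (dot u u) &
      forall u, dot u u = 0 -> u = 0].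

Section inner_product_theory.
Variables (R : realType) (V : lmodType R[i]) (dot : V -> V -> R[i]).
Hypothesis dotP : inner_product dot.
Implicit Types (u v w : V) (a : R[i]).
Local Notation norm := (hnorm dot).

Lemma dotDZl a u v w : dot (a *: u + v) w = a * dot u w + dot v w.
Proof. by case: dotP. Qed.

Lemma dot_conj u v : dot v u = conjc (dot u v).
Proof. by case: dotP. Qed.

Lemma dot0l w : dot 0 w = 0.
Proof.
have := dotDZl 1 0 0 w; rewrite scaler0 addr0 mul1r => h.
by apply: (addrI (dot 0 w)); rewrite addr0.
Qed.

Lemma dotZl a u w : dot (a *: u) w = a * dot u w.
Proof. by rewrite -[a *: u]addr0 dotDZl dot0l addr0. Qed.

Lemma dotDl u v w : dot (u + v) w = dot u w + dot v w.
Proof. by rewrite -[u]scale1r dotDZl mul1r scale1r. Qed.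

Lemma dotBl u v w : dot (u - v) w = dot u w - dot v w.
Proof. by rewrite -scaleN1r dotDl dotZl mulN1r. Qed.

Lemma dot0r w : dot w 0 = 0.
Proof. by rewrite dot_conj dot0l conjc0. Qed.

Lemma dotZr a u w : dot w (a *: u) = conjc a * dot w u.
Proof. by rewrite dot_conj dotZl conjcM -dot_conj. Qed.

Lemma dotDr u v w : dot w (u + v) = dot w u + dot w v.
Proof. by rewrite dot_conj dotDl conjcD -!dot_conj. Qed.

Lemma dot_suml (I : Type) (s : seq I) (P : pred I) (f : I -> V) w :
  dot (\sum_(i <- s | P i) f i) w = \sum_(i <- s | P i) dot (f i) w.
Proof. by elim/big_rec2: _ => [|i y x _ <-]; rewrite ?dot0l ?dotDl. Qed.

Lemma dot_sumr (I : Type) (s : seq I) (P : pred I) (f : I -> V) w :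
  dot w (\sum_(i <- s | P i) f i) = \sum_(i <- s | P i) dot w (f i).
Proof. by elim/big_rec2: _ => [|i y x _ <-]; rewrite ?dot0r ?dotDr. Qed.

Lemma hnorm_ge0 u : 0 <= norm u.
Proof. exact: sqrtr_ge0. Qed.

Lemma dotxx u : dot u u = (norm u ^+ 2)%:C.
Proof.
have [_ _ pos _] := dotP; rewrite sqr_sqrtr//.
have /(congr1 (@complex.Im R)) := dot_conj u u.
case: (dot u u) => a b /= h; have -> : b = 0 by lra.
by [].
Qed.

Lemma hnorm0 : norm 0 = 0.
Proof. by rewrite /hnorm dot0l sqrtr0. Qed.

Lemma hnorm_eq0 u : norm u = 0 -> u = 0.
Proof. by case: dotP => _ _ _ def h; apply: def; rewrite dotxx h expr0n. Qed.

Lemma hnormZ a u : norm (a *: u) = normc a * norm u.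
Proof.
have h : (norm (a *: u) ^+ 2)%:C = ((normc a * norm u) ^+ 2)%:C :> R[i].
  rewrite -dotxx dotZl dotZr mulrA mul_conjc dotxx exprMn.
  exact/esym/real_complexM.
apply/eqP; rewrite -(@eqrXn2 _ 2)// ?mulr_ge0 ?hnorm_ge0 ?normc_ge0//.
by apply/eqP; exact: complexI h.
Qed.

Lemma hnormN u : norm (- u) = norm u.
Proof. by rewrite -scaleN1r hnormZ normcN normc1 mul1r. Qed.

Lemma hnormB u v : norm (u - v) = norm (v - u).
Proof. by rewrite -hnormN opprB. Qed.

Lemma hnorm_pythag u v : dot u v = 0 -> norm (u + v) ^+ 2 = norm u ^+ 2 + norm v ^+ 2.
Proof.
move=> uv; apply: (@complexI R); rewrite -dotxx dotDl !dotDr uv.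
by rewrite (dot_conj u v) uv conjc0 addr0 add0r !dotxx real_complexD.
Qed.

Lemma CauchySchwarz u v : normc (dot u v) <= norm u * norm v.
Proof.
have [v0|v0] := eqVneq (norm v) 0.
  by rewrite (hnorm_eq0 v0) dot0r normc0 mulr_ge0 ?hnorm_ge0.
have vp : 0 < norm v by rewrite lt_neqAle eq_sym v0 hnorm_ge0.
(* The component of [u] orthogonal to [v], multiplied by [norm v ^+ 2] to avoid a division. *)
pose w := (norm v ^+ 2)%:C *: u - dot u v *: v.
have wv : dot w (dot u v *: v) = 0.
  by rewrite dotZr dotBl !dotZl dotxx [X in _ * (X - _)]mulrC subrr mulr0.
have := hnorm_pythag wv; rewrite subrK !hnormZ normc_real ?sqr_ge0// => h.
have : (normc (dot u v) * norm v) ^+ 2 <= (norm v ^+ 2 * norm u) ^+ 2.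
  by rewrite h lerDr sqr_ge0.
rewrite ler_sqr ?nnegrE ?mulr_ge0 ?sqr_ge0 ?hnorm_ge0 ?normc_ge0//.
by rewrite expr2 -mulrA mulrC ler_pM2l// mulrC.
Qed.

Lemma hnormD u v : norm (u + v) <= norm u + norm v.
Proof.
rewrite -ler_sqr ?nnegrE ?addr_ge0 ?hnorm_ge0//.
have -> : norm (u + v) ^+ 2 = norm u ^+ 2 + norm v ^+ 2 + 2 * complex.Re (dot u v).
  apply: (@complexI R); rewrite -dotxx dotDl !dotDr (dot_conj u v) !dotxx.
  rewrite !real_complexD (real_complexM 2) [2%:C](_ : _ = 2); last exact: (rmorph_nat _ 2).
  rewrite -addcJ.
  by ring.
have := le_trans (Re_le_normc (dot u v)) (CauchySchwarz u v).
by nra.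
Qed.

Lemma has_hsumP (J : choiceType) (f : J -> V) v : has_hsum dot f v <->
  forall e : R, 0 < e -> exists F0 : {fset J}, forall F : {fset J}, (F0 `<=` F)%fset ->
    norm (\sum_(k <- F) f k - v) < e.
Proof.
split=> [/cvgrPdist_lt h e /h[F0 _ hF]|h].
  exists F0 => F /hF /=; rewrite partial_sumE sub0r normrN ger0_norm//.
  exact: hnorm_ge0.
apply/cvgrPdist_lt => e /h[F0 hF]; exists F0 => // F /hF /=.
by rewrite partial_sumE sub0r normrN ger0_norm// hnorm_ge0.
Qed.

Lemma has_hsum_functional (J : choiceType) (f : J -> V) v (L : V -> R[i]) (M : R) :
  (forall a u w, L (a *: u + w) = a * L u + L w) ->
  (forall u, normc (L u) <= M * norm u) ->
  has_hsum dot f v -> has_csum (fun k => L (f k)) (L v).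
Proof.
move=> Llin LM /has_hsumP fv; apply/has_csumP => e e0.
have L0 : L 0 = 0.
  have := Llin 1 0 0; rewrite scaler0 addr0 mul1r => h.
  by apply: (addrI (L 0)); rewrite addr0.
have Lsum (F : {fset J}) : L (\sum_(k <- F) f k) = \sum_(k <- F) L (f k).
  elim/big_rec2: _ => // k y x _ <-.
  by rewrite -[f k]scale1r Llin mul1r scale1r.
have M1 : 0 < `|M| + 1 by rewrite ltr_wpDl.
have [F0 h] := fv (e / (`|M| + 1)) (divr_gt0 e0 M1).
exists F0 => F /h {}h; rewrite -Lsum normcB.
have -> : L (\sum_(k <- F) f k) - L v = L (\sum_(k <- F) f k - v).
  by rewrite addrC -mulN1r -Llin scaleN1r addrC.
apply: le_lt_trans (LM _) _.
apply: (@le_lt_trans _ _ ((`|M| + 1) * norm (\sum_(k <- F) f k - v))).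
  by rewrite ler_wpM2r ?hnorm_ge0// (le_trans (ler_norm M))// lerDl.
by rewrite mulrC -ltr_pdivlMr.
Qed.

End inner_product_theory.

(** * Expansions in an orthogonal, unnormalized system *)

Section orthogonal_systems.
Variables (R : realType) (V : lmodType R[i]) (dot : V -> V -> R[i]).
Variables (J : choiceType) (y : J -> V) (w : J -> R).
Hypothesis dotP : inner_product dot.
Hypothesis w_gt0 : forall k, 0 < w k.
Hypothesis dot_y : forall k l, dot (y k) (y l) = if k == l then (w k)^-1%:C else 0.
Implicit Types (x u v z : V) (k : J) (F : {fset J}).
Local Notation norm := (hnorm dot).

(** As [y k] has squared norm [1 / w k], the factor [w k] makes this the coefficient of [y k] in the
    expansion of [x]. *)
Definition hcoord x k : R[i] := (w k)%:C * dot x (y k).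

Definition hproj F x := \sum_(k <- F) hcoord x k *: y k.

Lemma hcoordZD a x u k : hcoord (a *: x + u) k = a * hcoord x k + hcoord u k.
Proof. by rewrite /hcoord (dotDZl dotP) mulrDr mulrCA. Qed.

Lemma hcoord0 k : hcoord 0 k = 0.
Proof. by rewrite /hcoord (dot0l dotP) mulr0. Qed.

Lemma hcoordZ a x k : hcoord (a *: x) k = a * hcoord x k.
Proof. by rewrite -[a *: x]addr0 hcoordZD hcoord0 addr0. Qed.

Lemma hcoordD x u k : hcoord (x + u) k = hcoord x k + hcoord u k.
Proof. by rewrite -[x]scale1r hcoordZD mul1r scale1r. Qed.

Lemma hcoordB x u k : hcoord (x - u) k = hcoord x k - hcoord u k.
Proof. by rewrite -scaleN1r hcoordD hcoordZ mulN1r. Qed.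

Lemma hcoord_sum (I : Type) (s : seq I) (P : pred I) (f : I -> V) k :
  hcoord (\sum_(i <- s | P i) f i) k = \sum_(i <- s | P i) hcoord (f i) k.
Proof. by rewrite /hcoord (dot_suml dotP) mulr_sumr. Qed.

Lemma dot_hcoord x k : dot x (y k) = hcoord x k * (w k)^-1%:C.
Proof.
rewrite /hcoord mulrAC -real_complexM mulfV ?mul1r//.
by rewrite gt_eqF.
Qed.

Lemma hcoord_y k l : hcoord (y k) l = (k == l)%:R.
Proof.
rewrite /hcoord dot_y; case: eqP => [->|_]; last by rewrite mulr0.
by rewrite -real_complexM mulfV ?gt_eqF.
Qed.

Lemma hcoord_hproj F x k : hcoord (hproj F x) k = if k \in F then hcoord x k else 0.
Proof.
rewrite hcoord_sum; case: ifP => kF.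
  rewrite (big_fsetD1 k)//= hcoordZ hcoord_y eqxx mulr1 big_seq_cond big1 ?addr0// => l.
  by rewrite !inE andbT => /andP[/negbTE lk _]; rewrite hcoordZ hcoord_y lk mulr0.
rewrite big_seq_cond big1// => l; rewrite andbT => lF.
rewrite hcoordZ hcoord_y; case: eqP => [lk|_]; last by rewrite mulr0.
by rewrite -lk lF in kF.
Qed.

Lemma hprojZD F a x u : hproj F (a *: x + u) = a *: hproj F x + hproj F u.
Proof.
rewrite /hproj scaler_sumr -big_split; apply: eq_bigr => k _.
by rewrite hcoordZD scalerDl scalerA.
Qed.

Lemma hprojB F x u : hproj F (x - u) = hproj F x - hproj F u.
Proof. by rewrite -scaleN1r addrC hprojZD scaleN1r addrC. Qed.

Lemma dot_hproj F x z :
  dot (hproj F x) z = \sum_(k <- F) hcoord x k * conjc (hcoord z k) * (w k)^-1%:C.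
Proof.
rewrite (dot_suml dotP); apply: eq_bigr => k _.
by rewrite (dotZl dotP) (dot_conj dotP) dot_hcoord conjcM conjc_real mulrA.
Qed.

Lemma dot_hprojC F x z : dot (hproj F x) z = dot x (hproj F z).
Proof.
rewrite (dot_conj dotP (hproj F z)) !dot_hproj rmorph_sum; apply: eq_bigr => k _ /=.
rewrite (conjcM (hcoord z k * _)) (conjcM (hcoord z k)) conjcK conjc_real.
by congr (_ * _); rewrite mulrC.
Qed.

Lemma hproj_id F x : hproj F (hproj F x) = hproj F x.
Proof.
rewrite [LHS]/hproj [RHS]/hproj big_seq [RHS]big_seq; apply: eq_bigr => k kF.
by rewrite hcoord_hproj kF.
Qed.

Lemma hnorm_hproj F x :
  norm (hproj F x) ^+ 2 = \sum_(k <- F) (w k)^-1 * normc (hcoord x k) ^+ 2.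
Proof.
apply: (@complexI R); rewrite -(dotxx dotP) dot_hprojC hproj_id -dot_hprojC dot_hproj.
rewrite (rmorph_sum (real_complex R)); apply: eq_bigr => k _ /=.
by rewrite mul_conjc -real_complexM mulrC.
Qed.

Lemma hnorm_hproj_pythag F x :
  norm x ^+ 2 = norm (hproj F x) ^+ 2 + norm (x - hproj F x) ^+ 2.
Proof.
have h : dot (hproj F x) (x - hproj F x) = 0.
  by rewrite dot_hprojC hprojB hproj_id subrr (dot0r dotP).
by rewrite -(hnorm_pythag dotP h) addrC subrK.
Qed.

Lemma hnorm_hproj_le F x : norm (hproj F x) <= norm x.
Proof.
rewrite -ler_sqr ?nnegrE ?hnorm_ge0 ?hnorm_ge0//.
by rewrite (hnorm_hproj_pythag F x) lerDl sqr_ge0.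
Qed.

Lemma hproj_best F x u : hproj F u = u -> norm (x - hproj F x) <= norm (x - u).
Proof.
move=> uF; rewrite -ler_sqr ?nnegrE ?hnorm_ge0//.
rewrite (hnorm_hproj_pythag F (x - u)) hprojB uF.
have -> : x - u - (hproj F x - u) = x - hproj F x by rewrite opprB addrA subrK.
by rewrite lerDr sqr_ge0.
Qed.

Lemma hproj_lin_span x : lin_span y x -> exists F0, forall F, (F0 `<=` F)%fset ->
  hproj F x = x.
Proof.
move=> [s ->]; exists [fset p.2 | p in s]%fset => F /fsubsetP sF.
rewrite /hproj.
under eq_bigr do rewrite hcoord_sum scaler_suml.
rewrite exchange_big/= big_seq [RHS]big_seq; apply: eq_bigr => p ps.
have pF : p.2 \in F by apply: sF; apply/imfsetP; exists p.
rewrite (big_fsetD1 p.2)//= hcoordZ hcoord_y eqxx mulr1 big_seq_cond big1 ?addr0// => l.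
rewrite !inE andbT eq_sym => /andP[/negbTE lk _].
by rewrite hcoordZ hcoord_y lk mulr0 scale0r.
Qed.

(** Proved before totality is assumed: it is applied in the full Fock space, where the [y^(k)] need
    not be total, to construct the projection onto F_s^2. *)
Lemma bessel x : (l2_mass (fun k => (w k)^-1)%R (hcoord x) <= (norm x ^+ 2)%R%:E)%E.
Proof.
apply: ge_ereal_sup => _ [A [finA _] <-].
rewrite fsbig_finite//= sumEFin lee_fin -hnorm_hproj.
by rewrite ler_sqr ?nnegrE ?hnorm_ge0 ?hnorm_hproj_le.
Qed.

Hypothesis y_total : forall x, hclosure dot (lin_span y) x.

Lemma hexpansion x : has_hsum dot (fun k => hcoord x k *: y k) x.
Proof.
apply/has_hsumP => e /(y_total x)[u us xu].
have [F0 h] := hproj_lin_span us; exists F0 => F /h {}h.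
rewrite (hnormB dotP); exact: le_lt_trans (hproj_best _ h) xu.
Qed.

Lemma hexpansionP x e : 0 < e -> exists F0, forall F, (F0 `<=` F)%fset ->
  norm (x - hproj F x) < e.
Proof.
move=> e0; have /has_hsumP/(_ _ e0)[F0 h] := hexpansion x.
by exists F0 => F /h; rewrite (hnormB dotP).
Qed.

Lemma hcoord_inj x u : (forall k, hcoord x k = hcoord u k) -> x = u.
Proof.
move=> xu; apply/subr0_eq/(hnorm_eq0 dotP)/eqP; rewrite eq_le hnorm_ge0// andbT.
apply/ler_addgt0Pr => e /(hexpansionP (x - u))[F0 /(_ _ (fsubset_refl _))].
have -> : hproj F0 (x - u) = 0.
  by rewrite /hproj big1// => k _; rewrite hcoordB xu subrr scale0r.
by rewrite subr0 add0r => /ltW.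
Qed.

Lemma parseval x : l2_mass (fun k => (w k)^-1) (hcoord x) = (norm x ^+ 2)%:E.
Proof.
apply/eqP; rewrite eq_le bessel/=; apply/lee_addgt0Pr => e e0.
have [|F0 /(_ _ (fsubset_refl _)) h] := @hexpansionP x (Num.sqrt e).
  by rewrite sqrtr_gt0.
rewrite (hnorm_hproj_pythag F0) EFinD leeD//.
  rewrite hnorm_hproj -sumEFin; apply: ereal_sup_ubound; exists [set` F0] => //.
  by rewrite fsbig_finite//= set_fsetK.
rewrite lee_fin -[leRHS]sqr_sqrtr ?(ltW e0)//.
by rewrite ler_sqr ?nnegrE ?hnorm_ge0 ?sqrtr_ge0// ltW.
Qed.

Lemma hcoord_norm_le x u : (forall k, normc (hcoord x k) <= normc (hcoord u k)) ->
  norm x <= norm u.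
Proof.
move=> h; rewrite -ler_sqr ?nnegrE ?hnorm_ge0// -lee_fin -!parseval.
apply: le_esum => k _; rewrite lee_fin ler_wpM2l ?invr_ge0 ?(ltW (w_gt0 k))//.
by rewrite ler_sqr ?nnegrE ?normc_ge0.
Qed.

Lemma has_csum_dot x z :
  has_csum (fun k => hcoord x k * conjc (hcoord z k) * (w k)^-1%:C) (dot x z).
Proof.
have := has_hsum_functional (L := dot^~ z) (M := norm z) _ _ (hexpansion x).
rewrite [X in has_csum X](_ : _ = fun k => hcoord x k * conjc (hcoord z k) * (w k)^-1%:C).
  apply=> [a u v|u]; first exact: (dotDZl dotP).
  by rewrite mulrC (CauchySchwarz dotP).
apply/funext => k.
by rewrite (dotZl dotP) (dot_conj dotP) dot_hcoord conjcM conjc_real mulrA.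
Qed.

(* Dominated convergence, with the coordinates of [u] as dominating family. *)
Lemma hnorm_cvg0 (z : nat -> V) u :
  (forall N k, normc (hcoord (z N) k) <= normc (hcoord u k)) ->
  (forall k (e : R), 0 < e -> exists N0, forall N, (N0 <= N)%N -> normc (hcoord (z N) k) < e) ->
  forall e : R, 0 < e -> exists N0, forall N, (N0 <= N)%N -> norm (z N) < e.
Proof.
move=> zu z0 e e0; have e2 : 0 < e / 2 by rewrite divr_gt0.
have [F /(_ _ (fsubset_refl _)) hF] := hexpansionP u e2.
(* If all squared coordinates in [F] are below [d], the part in [F] has squared norm at most
   [(e / 2) ^+ 2]; the summand 1 keeps the denominator positive. *)
pose d := (e / 2) ^+ 2 / ((\sum_(k <- F) (w k)^-1) + 1).
have S0 : 0 < (\sum_(k <- F) (w k)^-1) + 1.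
  by rewrite ltr_wpDl// sumr_ge0// => k _; rewrite invr_ge0 ltW.
have d0 : 0 < d by rewrite divr_gt0 ?exprn_gt0.
have [N0 hN0] : exists N0, forall N, (N0 <= N)%N -> forall k, k \in F ->
    normc (hcoord (z N) k) < Num.sqrt d.
  have sd0 : 0 < Num.sqrt d by rewrite sqrtr_gt0.
  pose N1 k := sval (cid (z0 k _ sd0)).
  exists (\max_(k <- F) N1 k) => N hN k kF.
  apply: (svalP (cid (z0 k _ sd0))); apply: leq_trans hN.
  exact: leq_bigmax_seq.
exists N0 => N /hN0 hN.
rewrite -ltr_sqr ?nnegrE ?hnorm_ge0 ?ltW// (hnorm_hproj_pythag F).
(* Outside [F] the tail of [u] dominates, uniformly in [N]. *)
have h1 : norm (z N - hproj F (z N)) < e / 2.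
  apply: le_lt_trans hF; apply: hcoord_norm_le => k.
  rewrite !hcoordB !hcoord_hproj; case: ifP => _; first by rewrite !subrr.
  by rewrite !subr0.
have h2 : norm (hproj F (z N)) ^+ 2 <= (e / 2) ^+ 2.
  rewrite hnorm_hproj; apply: (@le_trans _ _ (\sum_(k <- F) (w k)^-1 * d)).
    rewrite big_seq [leRHS]big_seq; apply: ler_sum => k kF.
    rewrite ler_wpM2l ?invr_ge0 ?(ltW (w_gt0 _))//.
    rewrite -[leRHS]sqr_sqrtr ?(ltW d0)// ler_sqr ?nnegrE ?normc_ge0 ?sqrtr_ge0//.
    exact/ltW/hN.
  rewrite -mulr_suml /d mulrCA ler_piMr ?sqr_ge0// ler_pdivrMr// mul1r.
  by rewrite lerDl.
by have := hnorm_ge0 dot (z N - hproj F (z N)); nra.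
Qed.

(** Both functionals can be applied to the expansion of [x] term by term. Identities such as the one
    for evaluation after [B_i] thereby reduce to the vectors [y k]. *)
Lemma functional_ext (L L' : V -> R[i]) (M M' : R) :
  (forall a u v, L (a *: u + v) = a * L u + L v) ->
  (forall a u v, L' (a *: u + v) = a * L' u + L' v) ->
  (forall v, normc (L v) <= M * norm v) -> (forall v, normc (L' v) <= M' * norm v) ->
  (forall k, L (y k) = L' (y k)) -> L =1 L'.
Proof.
move=> Ll Ll' LM LM' LL' x.
have h := has_hsum_functional Ll LM (hexpansion x).
have h' := has_hsum_functional Ll' LM' (hexpansion x).
apply: has_csum_inj h _; move: h'; congr has_csum; apply/funext => k.
have z0 (T : V -> R[i]) : (forall a u v, T (a *: u + v) = a * T u + T v) -> T 0 = 0.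
  move=> Tl; have := Tl 1 0 0; rewrite scaler0 addr0 mul1r => h0.
  by apply: (addrI (T 0)); rewrite addr0.
by rewrite -[_ *: _]addr0 Ll Ll' !z0// LL'.
Qed.

End orthogonal_systems.

(** * Bounded operators *)

Section bounded_operators.
Variables (R : realType) (V : lmodType R[i]) (dot : V -> V -> R[i]).
Hypothesis dotP : inner_product dot.
Implicit Types (A T : V -> V) (a : R[i]).
Local Notation norm := (hnorm dot).

Lemma linear_fun0 A : linear A -> A 0 = 0.
Proof.
move=> Al; have := Al 1 0 0; rewrite !scaler0 scale1r !addr0 => h.
by apply: (addrI (A 0)); rewrite addr0.
Qed.

Lemma linear_funZ A a u : linear A -> A (a *: u) = a *: A u.
Proof. by move=> Al; rewrite -[a *: u]addr0 Al linear_fun0// addr0. Qed.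

Lemma linear_funD A u v : linear A -> A (u + v) = A u + A v.
Proof. by move=> Al; rewrite -[u]scale1r Al !scale1r. Qed.

Lemma linear_funB A u v : linear A -> A (u - v) = A u - A v.
Proof. by move=> Al; rewrite -scaleN1r linear_funD// linear_funZ// scaleN1r. Qed.

Lemma linear_fun_sum A (I : Type) (s : seq I) (P : pred I) (f : I -> V) : linear A ->
  A (\sum_(i <- s | P i) f i) = \sum_(i <- s | P i) A (f i).
Proof.
move=> Al; elim/big_rec2: _ => [|i y x _ <-]; first exact: linear_fun0.
by rewrite linear_funD.
Qed.

Lemma bounded_opP A : bounded_op dot A ->
  exists2 M : R, 0 <= M & forall v, norm (A v) <= M * norm v.
Proof.
move=> [_ [M AM]]; exists (`|M|) => // v; apply: le_trans (AM v) _.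
by rewrite ler_wpM2r ?hnorm_ge0 ?ler_norm.
Qed.

Lemma bounded_op_id : bounded_op dot id.
Proof. by split=> //; exists 1 => v; rewrite mul1r. Qed.

Lemma bounded_op_comb a A T : bounded_op dot A -> bounded_op dot T ->
  bounded_op dot (fun v => a *: A v + T v).
Proof.
move=> bA bT; have [M M0 AM] := bounded_opP bA; have [M' M'0 TM] := bounded_opP bT.
case: bA bT => Al _ [Tl _]; split.
  by move=> b u v; rewrite Al Tl !scalerDr !scalerA addrACA (mulrC a).
exists (normc a * M + M') => v; apply: le_trans (hnormD dotP _ _) _.
rewrite mulrDl lerD// (hnormZ dotP) -mulrA ler_wpM2l ?normc_ge0//.
Qed.

Lemma bounded_op_comp A T : bounded_op dot A -> bounded_op dot T ->
  bounded_op dot (A \o T).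
Proof.
move=> bA bT; have [M M0 AM] := bounded_opP bA; have [M' M'0 TM] := bounded_opP bT.
case: bA bT => Al _ [Tl _]; split; first by move=> b u v; rewrite /= Tl Al.
exists (M * M') => v /=; apply: le_trans (AM _) _.
by rewrite -mulrA ler_wpM2l.
Qed.

Lemma has_hsum_bounded_op (J : choiceType) (f : J -> V) v A : bounded_op dot A ->
  has_hsum dot f v -> has_hsum dot (fun k => A (f k)) (A v).
Proof.
move=> bA /has_hsumP fv; apply/has_hsumP => e e0.
have [M M0 AM] := bounded_opP bA; case: bA => Al _.
have M1 : 0 < M + 1 by rewrite ltr_wpDl.
have [F0 h] := fv (e / (M + 1)) (divr_gt0 e0 M1); exists F0 => F /h {}h.
rewrite -linear_fun_sum// -linear_funB//; apply: le_lt_trans (AM _) _.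
apply: (@le_lt_trans _ _ ((M + 1) * norm (\sum_(k <- F) f k - v))).
  by rewrite ler_wpM2r ?hnorm_ge0// lerDl.
by rewrite mulrC -ltr_pdivlMr.
Qed.

End bounded_operators.

(** * The inner product of l2 *)

Section l2_inner_product.
Variables (R : realType) (I : choiceType).
Implicit Types (x y z : l2 R I) (i : I).

Lemma has_csum_l2_sqr x :
  has_csum (fun i => (normc (x i) ^+ 2)%:C) (fine (l2_mass (fun=> 1) x))%:C.
Proof.
have -> : (fun i => (normc (x i) ^+ 2)%:C) = (fun i => (1 * normc (x i) ^+ 2)%:C :> R[i]).
  by apply/funext => i; rewrite mul1r.
apply: has_csum_real; apply: partial_sum_esum => [i|]; first by rewrite mul1r sqr_ge0.
by have := l2_funP x; rewrite inE.
Qed.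

(** Polarization: termwise, the product is a combination of the four squares [|a x + y|^2] with [a]
    among 1, -1, i, -i, and these have convergent sums. *)
Lemma has_csum_l2_dot x y : has_csum (fun i => x i * conjc (y i)) (l2_dot x y).
Proof.
suff [s h] : exists s, has_csum (fun i => x i * conjc (y i)) s.
  by have -> : l2_dot x y = s by exact: has_csum_unique.
have q a := has_csum_l2_sqr (x := a *: x + y).
pose S a : R[i] := (fine (l2_mass (fun=> 1) (a *: x + y)))%:C.
exists ((1 / 4) * S 1 + (- 1 / 4) * S (- 1) + ((- 'i%C / 4) * S 'i%C + ('i%C / 4) * S (- 'i%C))).
have := has_csumD (has_csumD (has_csumZ (a := 1 / 4) (q 1)) (has_csumZ (a := -1 / 4) (q (-1))))
  (has_csumD (has_csumZ (a := - 'i%C / 4) (q 'i%C)) (has_csumZ (a := 'i%C / 4) (q (- 'i%C)))).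
congr has_csum; apply/funext => i.
have E a : (normc ((a *: x + y) i) ^+ 2)%:C =
    (a * x i + y i) * (conjc a * conjc (x i) + conjc (y i)).
  by rewrite -mul_conjc -conjcM -conjcD.
have c1 : conjc (1 : R[i]) = 1 by exact: conjc1.
have cN1 : conjc (-1 : R[i]) = -1 by apply/eqP; rewrite eq_complex/= ?oppr0 ?oppr0 !eqxx.
have ci : conjc ('i%C : R[i]) = - 'i%C by apply/eqP; rewrite eq_complex/= ?oppr0 ?oppr0 !eqxx.
have cNi : conjc (- 'i%C : R[i]) = 'i%C by apply/eqP; rewrite eq_complex/= ?oppr0 ?opprK !eqxx.
rewrite !E c1 cN1 ci cNi.
have := sqr_i R; move: (x i) (conjc (x i)) (y i) (conjc (y i)) ('i%C : R[i]) => X X' Y Y' J J2.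
have J2' : J * J = -1 by rewrite -J2 expr2.
by field: J2'.
Qed.

Lemma l2_inner_product : inner_product (@l2_dot R I).
Proof.
split.
- move=> a x y z; apply: has_csum_unique.
  have := has_csum_lin (a := a) (has_csum_l2_dot (x := x) (y := z))
    (has_csum_l2_dot (x := y) (y := z)).
  by congr has_csum; apply/funext => i; rewrite [RHS]mulrDl mulrA.
- move=> x y; apply: has_csum_unique.
  have := has_csum_conj (has_csum_l2_dot (x := x) (y := y)).
  by congr has_csum; apply/funext => i; rewrite conjcM conjcK mulrC.
- by move=> x; rewrite l2_dotxx/= fine_ge0// l2_mass_ge0.
- move=> x; rewrite l2_dotxx => /(congr1 (@complex.Re R))/= x0.
  apply/val_inj/funext => i /=; apply: eq0_normc; apply/eqP; rewrite -sqrf_eq0 eq_le sqr_ge0 andbT.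
  have xoo : (l2_mass (fun=> 1%R) x < +oo)%E by have := l2_funP x; rewrite inE.
  have xfin : l2_mass (fun=> 1%R) x \is a fin_num by rewrite ge0_fin_numE// l2_mass_ge0.
  rewrite -lee_fin -[leRHS]/(0%:E) -x0 fineK//.
  apply: ereal_sup_ubound; exists [set i] => //.
  by rewrite fsbig_set1/= mul1r.
Qed.

Lemma l2_dot_basis x i : l2_dot x (l2_basis R i) = x i.
Proof.
apply: has_csum_inj (has_csum_l2_dot (x := x) (y := l2_basis R i)) _.
have := has_csum_delta i (a := x i); congr has_csum.
apply/funext => j; rewrite (conjc_nat R (j == i) : conjc (l2_basis R i j) = _).
by case: eqP => [->|_]; rewrite ?mulr1 ?mulr0.
Qed.

Lemma hnorm_l2_le (x : l2 R I) (M : R) : 0 <= M ->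
  (l2_mass (fun=> 1%R) x <= (M ^+ 2)%:E)%E -> hnorm (@l2_dot R I) x <= M.
Proof. by move=> M0; rewrite -hnorm_sqr lee_fin ler_sqr ?nnegrE ?hnorm_ge0. Qed.

End l2_inner_product.

(** [F0] has a partial sum within [e] of the total; terms outside [F0] added to it still cannot
    exceed the total. *)
Lemma esum_tail (R : realType) (I : choiceType) (g : I -> R) (e : R) :
  (forall i, 0 <= g i) -> (\esum_(i in setT) (g i)%:E < +oo)%E -> 0 < e ->
  exists F0 : {fset I}, forall J : {fset I}, \sum_(i <- J | i \notin F0) g i < e.
Proof.
move=> g0 goo e0.
have gfin : (\esum_(i in setT) (g i)%:E)%E \is a fin_num.
  by rewrite ge0_fin_numE// esum_ge0// => i _; rewrite lee_fin.
have /cvgrPdist_lt/(_ _ e0)[F0 _ /(_ _ (fsubset_refl F0))/=] := partial_sum_esum g0 goo.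
rewrite partial_sumE => h; exists F0 => J.
have : \sum_(i <- J | i \notin F0) g i + \sum_(i <- F0) g i <=
    fine (\esum_(i in setT) (g i)%:E)%E.
  rewrite -lee_fin fineK//.
  apply: (@le_trans _ _ (\sum_(i <- (J `|` F0)%fset) g i)%:E%R).
    rewrite lee_fin [leRHS](big_fsetID _ (mem F0))/= addrC lerD//.
      rewrite [X in _ <= \sum_(i <- enum_fset X) _](_ : _ = [fset x in J | x \notin F0]%fset).
        by rewrite [leRHS]big_fset.
      by apply/fsetP => i; rewrite !inE/=; case: (i \in F0); rewrite ?orbT ?orbF ?andbF.
    rewrite [X in _ <= \sum_(i <- enum_fset X) _](_ : _ = F0)//.
    by apply/fsetP => i; rewrite !inE/=; case: (i \in F0); rewrite ?orbT ?andbF.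
  rewrite -sumEFin; apply: ereal_sup_ubound; exists [set` (J `|` F0)%fset] => //.
  by rewrite fsbig_finite//= set_fsetK.
move: h; set s := fine _; set S := \sum_(i <- F0) _; set T := \sum_(i <- J | _) _ => h hT.
by have := ler_norm (s - S); lra.
Qed.

(** * Multi-indices, words and monomials *)

Section multiindices.
Variable n : nat.
Local Notation multiindex := (multiindex n).
Implicit Types (k p q : multiindex) (i : 'I_n) (a b : word n).

Definition mdelta i : multiindex := [ffun j => (j == i : nat)].
Definition madd k p : multiindex := [ffun j => (k j + p j)%N].
Definition msub k p : multiindex := [ffun j => (k j - p j)%N].
Definition mle p k := [forall j, (p j <= k j)%N].
Definition wcount a : multiindex := [ffun j => count_mem j a].
Definition mzero : multiindex := [ffun => 0%N].

Lemma maddC k p : madd k p = madd p k.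
Proof. by apply/ffunP => j; rewrite !ffunE addnC. Qed.

Lemma madd0 k : madd k mzero = k.
Proof. by apply/ffunP => j; rewrite !ffunE addn0. Qed.

Lemma maddK k p : msub (madd k p) p = k.
Proof. by apply/ffunP => j; rewrite !ffunE addnK. Qed.

Lemma msubK k p : mle p k -> madd (msub k p) p = k.
Proof. by move=> /forallP h; apply/ffunP => j; rewrite !ffunE subnK. Qed.

Lemma mle_madd k p : mle p (madd k p).
Proof. by apply/forallP => j; rewrite ffunE leq_addl. Qed.

Lemma mle_mdelta i k : mle (mdelta i) k = (k i != 0%N).
Proof.
apply/forallP/idP => [/(_ i)|ki j]; first by rewrite ffunE eqxx lt0n.
by rewrite ffunE; case: eqP => [->|]; rewrite ?lt0n.
Qed.

Lemma mdegreeD k p : mdegree (madd k p) = (mdegree k + mdegree p)%N.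
Proof. by rewrite /mdegree -big_split; apply: eq_bigr => i _; rewrite ffunE. Qed.

Lemma mdegree_mdelta i : mdegree (mdelta i) = 1%N.
Proof.
rewrite /mdegree (bigD1 i)//= ffunE eqxx big1 ?addn0// => j ji.
by rewrite ffunE (negbTE ji).
Qed.

Lemma mdegree_ge k i : (k i <= mdegree k)%N.
Proof. by rewrite /mdegree (bigD1 i)//= leq_addr. Qed.

Lemma multiindex_ind (P : multiindex -> Prop) :
  P mzero -> (forall k i, P k -> P (madd k (mdelta i))) -> forall k, P k.
Proof.
move=> P0 PS k; elim: {k}(mdegree k) {-2}k (leqnn (mdegree k)) => [|d IH] k kd.
  have -> // : k = mzero.
  apply/ffunP => i; rewrite ffunE; apply/eqP; rewrite -leqn0.
  exact: leq_trans (mdegree_ge k i) kd.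
have [[i ki]|k0] := pselect (exists i, k i != 0%N); last first.
  have -> // : k = mzero.
  by apply/ffunP => i; rewrite ffunE; apply/eqP/negPn/negP => ki; apply: k0; exists i.
rewrite -mle_mdelta in ki; rewrite -(msubK ki); apply/PS/IH.
by rewrite -ltnS; apply: leq_trans kd; rewrite -[in leqRHS](msubK ki) mdegreeD mdegree_mdelta addn1.
Qed.

Lemma wcount_cons i a : wcount (i :: a) = madd (wcount a) (mdelta i).
Proof. by apply/ffunP => j; rewrite !ffunE/= addnC eq_sym. Qed.

Lemma wcount_nil : wcount [::] = mzero.
Proof. by apply/ffunP => j; rewrite !ffunE. Qed.

Lemma mdegree_wcount a : mdegree (wcount a) = size a.
Proof.
elim: a => [|i a IH]; last by rewrite wcount_cons mdegreeD mdegree_mdelta IH addn1.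
by rewrite wcount_nil /mdegree big1// => i _; rewrite ffunE.
Qed.

Lemma wcount_surj k : exists a, wcount a = k.
Proof.
elim/multiindex_ind: k => [|k i [a <-]]; first by exists [::]; rewrite wcount_nil.
by exists (i :: a); rewrite wcount_cons.
Qed.

Lemma finite_wcount k : finite_set [set a | wcount a = k].
Proof.
apply: (@sub_finite_set _ _ [set` [fset val t | t : (mdegree k).-tuple 'I_n]%fset]) => //.
move=> a /= ak; apply/imfsetP.
have sa : size a == mdegree k by rewrite -ak mdegree_wcount.
by exists (Tuple sa).
Qed.

Lemma finite_mdegree_le N : finite_set [set k : multiindex | (mdegree k <= N)%N].
Proof.
pose h (f : {ffun 'I_n -> 'I_N.+1}) : multiindex := [ffun i => nat_of_ord (f i)].
apply: (@sub_finite_set _ _ [set` [fset h f | f : {ffun 'I_n -> 'I_N.+1}]%fset]) => //.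
move=> k /= kN; apply/imfsetP; exists [ffun i => inord (k i)] => //.
apply/ffunP => i; rewrite !ffunE inordK// ltnS.
exact: leq_trans (mdegree_ge k i) kN.
Qed.

Section monomials.
Variable R : realType.
Implicit Type l : 'rV[R[i]^o]_n.

Lemma monomialD l k p : monomial l (madd k p) = monomial l k * monomial l p.
Proof. by rewrite /monomial -big_split; apply: eq_bigr => i _; rewrite ffunE exprD. Qed.

Lemma monomial0 l : monomial l mzero = 1.
Proof. by rewrite /monomial big1// => i _; rewrite ffunE. Qed.

Lemma monomial_mdelta l i : monomial l (mdelta i) = l ord0 i.
Proof.
rewrite /monomial (bigD1 i)//= ffunE eqxx expr1 big1 ?mulr1// => j ji.
by rewrite ffunE (negbTE ji).
Qed.

Lemma word_monomialE l a : word_monomial l a = monomial l (wcount a).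
Proof.
elim: a => [|i a IH]; first by rewrite wcount_nil monomial0 /word_monomial big_nil.
by rewrite wcount_cons monomialD monomial_mdelta -IH /word_monomial big_cons mulrC.
Qed.

Lemma LambdaE k : Lambda R k = [set a | wcount a = k].
Proof.
apply/seteqP; split=> a /=; last by move=> <- l; exact: word_monomialE.
move=> h; apply/ffunP => i.
(* At the point with entry 2 at [i] and 1 elsewhere a monomial takes the value 2 to the power of its
   [i]-th exponent, which recovers that exponent. *)
have := h (\row_j (if j == i then 2 else 1)); rewrite word_monomialE.
have E p : monomial (\row_j (if j == i then 2 else 1) : 'rV[R[i]^o]_n) p = 2 ^+ p i.
  rewrite /monomial (bigD1 i)//= mxE eqxx big1 ?mulr1// => j ji.
  by rewrite mxE (negbTE ji) expr1n.
rewrite !E -!natrX => /eqP; rewrite eqr_nat => /eqP h2.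
exact: (@expnI 2).
Qed.

Lemma finite_Lambda k : finite_set (Lambda R k).
Proof. by rewrite LambdaE; exact: finite_wcount. Qed.

Lemma in_Lambda k a : (a \in fset_set (Lambda R k)) = (wcount a == k).
Proof.
rewrite in_fset_set; last exact: finite_Lambda.
by rewrite LambdaE; apply/idP/eqP; rewrite inE.
Qed.

End monomials.
End multiindices.

(** * The vectors [y^(k)] and their coordinates *)

Section symmetric_Fock_basis.
Variables (R : realType) (n : nat) (mu : weights R n).
Local Notation C := R[i].
Local Notation multiindex := (multiindex n).
Local Notation Fock := (l2 R (word n)).
Local Notation dotF := (@l2_dot R (word n)).
Implicit Types (k p q : multiindex) (a b : word n).

Lemma suffix_prod_gt0 a : 0 < suffix_prod mu a.
Proof. by elim: a => [|i a IH] //=; rewrite mulr_gt0// weight_gt0. Qed.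

Lemma omegaE k : omega mu k = \sum_(a <- fset_set (Lambda R k)) (suffix_prod mu a ^+ 2)^-1.
Proof. by rewrite /omega fsbig_finite//; exact: finite_Lambda. Qed.

Lemma omega_gt0 k : 0 < omega mu k.
Proof.
have [a ak] := wcount_surj k.
have aL : a \in fset_set (Lambda R k) by rewrite in_Lambda ak.
rewrite omegaE (big_fsetD1 a)//= ltr_pwDl ?invr_gt0 ?exprn_gt0 ?suffix_prod_gt0//.
by apply: sumr_ge0 => b _; rewrite invr_ge0 sqr_ge0.
Qed.

Lemma dot_y_vec (x : Fock) k : dotF x (y_vec mu k) =
  ((omega mu k)^-1)%:C *
    \sum_(a <- fset_set (Lambda R k)) ((suffix_prod mu a)^-1)%:C * x a.
Proof.
have dP := l2_inner_product R (word n).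
rewrite /y_vec fsbig_finite; last exact: finite_Lambda.
rewrite (dotZr dP) conjc_real (dot_sumr dP); congr (_ * _).
by apply: eq_bigr => a _; rewrite (dotZr dP) conjc_real l2_dot_basis.
Qed.

Lemma hcoord_y_vec (x : Fock) k : hcoord dotF (y_vec mu) (omega mu) x k =
  \sum_(a <- fset_set (Lambda R k)) ((suffix_prod mu a)^-1)%:C * x a.
Proof.
by rewrite /hcoord dot_y_vec mulrA -real_complexM mulfV ?mul1r// gt_eqF ?omega_gt0.
Qed.

Lemma y_vecE k a : y_vec mu k a =
  if wcount a == k then ((omega mu k * suffix_prod mu a)^-1)%:C else 0.
Proof.
have dP := l2_inner_product R (word n).
rewrite -(l2_dot_basis (y_vec mu k) a) (dot_conj dP) dot_y_vec conjcM conjc_real.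
case: ifP => ak; last first.
  rewrite big_seq big1 ?conjc0 ?mulr0// => b; rewrite in_Lambda => bk /=.
  by rewrite [b == a](_ : _ = false) ?mulr0//; apply/eqP => ba; rewrite -ba bk in ak.
rewrite (big_fsetD1 a) ?in_Lambda//= eqxx mulr1 big_seq big1 ?addr0.
  by rewrite conjc_real -real_complexM -invfM.
by move=> b; rewrite !inE => /andP[/negbTE -> _]; rewrite mulr0.
Qed.

Lemma dot_y_vec_y k p : dotF (y_vec mu k) (y_vec mu p) =
  if k == p then ((omega mu k)^-1)%:C else 0.
Proof.
rewrite dot_y_vec; case: eqP => [<-|kp]; last first.
  rewrite big_seq big1 ?mulr0// => a; rewrite in_Lambda => /eqP ap.
  by rewrite y_vecE ap; case: eqP => [/esym//|_]; rewrite mulr0.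
rewrite -[RHS]mulr1; congr (_ * _).
rewrite (_ : 1 = ((omega mu k)^-1 * omega mu k)%:C); last first.
  by rewrite mulVf// gt_eqF// omega_gt0.
rewrite [X in (_ * X)%:C]omegaE mulr_sumr (rmorph_sum (real_complex R)) big_seq [RHS]big_seq.
apply: eq_bigr => a; rewrite in_Lambda y_vecE => ->.
by rewrite -real_complexM invfM mulrCA -invfM -expr2.
Qed.

(* The vector of the Fock space that represents [\sum_k c k *: y_vec k]. *)
Definition sym_fun (c : multiindex -> C) a : C :=
  c (wcount a) * ((omega mu (wcount a) * suffix_prod mu a)^-1)%:C.

(** The words of [Lambda k] together contribute [|c k|^2 / (omega k)^2] times [omega k], by the
    definition of [omega]. A finite set of words may contain only some of [Lambda k], whence the
    inequality. *)
Lemma sym_fun_mass c :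
  (l2_mass (fun=> 1%R) (sym_fun c) <= l2_mass (fun k => (omega mu k)^-1)%R c)%E.
Proof.
apply: ge_ereal_sup => _ [A [finA _] <-].
rewrite fsbig_finite//= sumEFin.
pose K := [fset wcount a | a in fset_set A]%fset.
apply: (@le_trans _ _ (\sum_(k <- K) (omega mu k)^-1 * normc (c k) ^+ 2)%:E%R); last first.
  rewrite -sumEFin; apply: ereal_sup_ubound; exists [set` K] => //.
  by rewrite fsbig_finite ?set_fsetK.
rewrite lee_fin (partition_big_imfset _ (@wcount n))/= -/K.
apply: ler_sum => k _.
have sq a : wcount a = k -> 1 * normc (sym_fun c a) ^+ 2 =
    (omega mu k)^-1 * normc (c k) ^+ 2 * ((omega mu k)^-1 * (suffix_prod mu a ^+ 2)^-1).
  move=> ak; rewrite mul1r /sym_fun ak normcM normc_real; last first.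
    by rewrite invr_ge0 mulr_ge0// ltW ?omega_gt0 ?suffix_prod_gt0.
  field; rewrite !gt_eqF ?omega_gt0 ?suffix_prod_gt0//.
rewrite -[leRHS]mulr1 -[X in _ <= _ * X](@mulVf _ (omega mu k)) ?gt_eqF ?omega_gt0//.
rewrite [X in _ <= _ * (_ * X)]omegaE !mulr_sumr.
have -> : \sum_(a <- fset_set A | wcount a == k) (1 * normc (sym_fun c a) ^+ 2) =
   \sum_(a <- [fset a in fset_set A | wcount a == k]%fset) (1 * normc (sym_fun c a) ^+ 2).
  by rewrite [RHS]big_fset.
rewrite [leRHS](big_fsetID _ (mem A))/=.
apply: ler_wpDr.
  apply: sumr_ge0 => a _; rewrite mulr_ge0// mulr_ge0// ?sqr_ge0 ?invr_ge0 ?sqr_ge0//.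
    by rewrite ltW ?omega_gt0.
  by rewrite ltW ?omega_gt0.
rewrite [X in _ <= \sum_(a <- enum_fset X) _](_ : _ = [fset a in fset_set A | wcount a == k]%fset).
  rewrite big_seq [leRHS]big_seq; apply: ler_sum => a.
  by rewrite !inE/= => /andP[_ /eqP/sq ->].
by apply/fsetP => a; rewrite !inE/= in_Lambda in_fset_set// andbC.
Qed.

End symmetric_Fock_basis.

(** * The symmetric Fock space as a weighted l2 space *)

Section symmetric_Fock_space.
Variables (R : realType) (n : nat) (mu : weights R n).
Local Notation C := R[i].
Local Notation multiindex := (multiindex n).
Local Notation Fock := (l2 R (word n)).
Local Notation dotF := (@l2_dot R (word n)).
Local Notation dotS := (Fs2_dot mu).
Implicit Types (k p q : multiindex) (a b : word n) (x z : Fs2 mu).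

Lemma Fs2_inner_product : inner_product dotS.
Proof.
have [l c p d] := l2_inner_product R (word n); split.
- move=> a u v w; exact: l.
- by move=> u v; exact: c.
- by move=> u; exact: p.
- by move=> u /d u0; exact: val_inj.
Qed.

Lemma Fs2_dot_y k p : dotS (Fs2_y mu k) (Fs2_y mu p) =
  if k == p then ((omega mu k)^-1)%:C else 0.
Proof. exact: dot_y_vec_y. Qed.

Lemma Fs2_valB x z : Fs2_val (x - z) = Fs2_val x - Fs2_val z.
Proof. by []. Qed.

Lemma Fs2_val_sum (I : Type) (s : seq I) (f : I -> Fs2 mu) :
  Fs2_val (\sum_(i <- s) f i) = \sum_(i <- s) Fs2_val (f i).
Proof. by elim/big_rec2: _ => // i u v _ <-. Qed.

Lemma Fs2_total x : hclosure dotS (lin_span (Fs2_y mu)) x.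
Proof.
move=> e e0; have /set_mem/(_ e e0)[u [s us] xu] := Fs2_valP x.
exists (\sum_(p <- s) p.1 *: Fs2_y mu p.2); first by exists s.
have E : Fs2_val (x - \sum_(p <- s) p.1 *: Fs2_y mu p.2) = Fs2_val x - u.
  by rewrite Fs2_valB Fs2_val_sum us.
by rewrite /hnorm /Fs2_dot E.
Qed.

Definition ycoord x k : C := hcoord dotS (Fs2_y mu) (omega mu) x k.

(** Completeness in concrete form. The mass bound puts [sym_fun c] into the Fock space; it lies in
    the closed span because subtracting the terms in a large finite [F] leaves a vector of the same
    kind with small mass. *)
Lemma ycoord_lift (c : multiindex -> C) :
  (l2_mass (fun k => (omega mu k)^-1)%R c < +oo)%E -> exists x, ycoord x = c.
Proof.
move=> coo.
have sP (d : multiindex -> C) : (l2_mass (fun k => (omega mu k)^-1)%R d < +oo)%E ->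
    sym_fun mu d \in @l2_pred R (word n).
  by move=> doo; rewrite inE; apply: le_lt_trans doo; exact: sym_fun_mass.
have X : L2 (sP c coo) \in Fs2_pred mu.
  apply: mem_set => e e0; set X := L2 (sP c coo).
  have g0 k : 0 <= (omega mu k)^-1 * normc (c k) ^+ 2.
    by rewrite mulr_ge0 ?sqr_ge0// invr_ge0 omega_ge0.
  have e20 : 0 < (e / 2) ^+ 2 by rewrite exprn_gt0// divr_gt0.
  have [F hF] := esum_tail g0 coo e20.
  exists (\sum_(k <- F) c k *: y_vec mu k).
    by exists [seq (c k, k) | k <- F]; rewrite big_map.
  (* The coefficients of the remainder, which is [sym_fun d]. *)
  pose d k := if k \in F then 0 else c k.
  apply: (@le_lt_trans _ _ (e / 2)); last by rewrite ltr_pdivrMr// ltr_pMr// ltr1n.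
  apply: hnorm_l2_le; first by rewrite divr_ge0// ltW.
  have -> : ((X - \sum_(k <- F) c k *: y_vec mu k : Fock) : word n -> C) = sym_fun mu d.
    apply/funext => a.
    have E : (\sum_(k <- F) c k *: y_vec mu k : Fock) a =
        if wcount a \in F then sym_fun mu c a else 0.
      rewrite -l2_dot_basis (dot_suml (l2_inner_product R (word n))).
      under eq_bigr do rewrite (dotZl (l2_inner_product R (word n))) l2_dot_basis y_vecE.
      case: ifP => aF.
        rewrite (big_fsetD1 (wcount a))//= eqxx big_seq big1 ?addr0// => k.
        by rewrite !inE eq_sym => /andP[/negbTE -> _]; rewrite mulr0.
      rewrite big_seq big1// => k kF; case: eqP => [ak|_]; last by rewrite mulr0.
      by rewrite ak kF in aF.
    rewrite -[LHS]/(sym_fun mu c a - (\sum_(k <- F) c k *: y_vec mu k : Fock) a) E.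
    by rewrite /sym_fun /d; case: ifP => _; rewrite ?subrr ?mul0r ?subr0.
  apply: le_trans (sym_fun_mass _ _) _; apply: ge_ereal_sup => _ [A [finA _] <-].
  rewrite fsbig_finite//= sumEFin lee_fin; apply: ltW; apply: le_lt_trans (hF (fset_set A)).
  rewrite [leRHS]big_mkcond/= le_eqVlt; apply/orP; left; apply/eqP/eq_bigr => k _.
  by rewrite /d; case: (k \in F) => //; rewrite normc0 expr0n mulr0.
exists (SymFock X); apply/funext => k.
rewrite /ycoord -[LHS]/(hcoord dotF (y_vec mu) (omega mu) (L2 (sP c coo)) k).
rewrite hcoord_y_vec -[RHS]mulr1 (_ : 1 = (omega mu k * (omega mu k)^-1)%:C); last first.
  by rewrite mulfV// gt_eqF// omega_gt0.
rewrite [X in (X * _)%:C]omegaE mulr_suml (rmorph_sum (real_complex R)) mulr_sumr.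
rewrite big_seq [RHS]big_seq.
apply: eq_bigr => a; rewrite in_Lambda => /eqP ak /=.
rewrite /sym_fun ak mulrCA; congr (_ * _); rewrite -!real_complexM.
by congr (_%:C); field; rewrite !gt_eqF ?omega_gt0 ?suffix_prod_gt0.
Qed.

End symmetric_Fock_space.

(** * The operators [B_i] as shifts of multi-indices *)

Section compressed_shifts.
Variables (R : realType) (n : nat) (mu : weights R n).
Local Notation C := R[i].
Local Notation multiindex := (multiindex n).
Local Notation Fock := (l2 R (word n)).
Local Notation dotF := (@l2_dot R (word n)).
Local Notation dotS := (Fs2_dot mu).
Implicit Types (k p q : multiindex) (a b : word n) (x z : Fs2 mu) (T S : Fs2 mu -> Fs2 mu).
Let dotFP := l2_inner_product R (word n).
Let dotSP := Fs2_inner_product mu.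
Let omega0 := omega_gt0 mu.
Let dot_yS := Fs2_dot_y mu.
Let totalS := @Fs2_total R n mu.

Lemma ycoord_inj x z : ycoord x = ycoord z -> x = z.
Proof.
move=> xz; apply: (hcoord_inj dotSP omega0 dot_yS totalS) => k.
by rewrite -!/(ycoord _ k) xz.
Qed.

Lemma ycoordZD (c : C) x z k : ycoord (c *: x + z) k = c * ycoord x k + ycoord z k.
Proof. exact: (hcoordZD _ _ dotSP). Qed.

Lemma ycoord0 k : ycoord (0 : Fs2 mu) k = 0.
Proof. exact: (hcoord0 _ _ dotSP). Qed.

Lemma ycoordB x z k : ycoord (x - z) k = ycoord x k - ycoord z k.
Proof. exact: (hcoordB _ _ dotSP). Qed.

Lemma ycoordZ (c : C) x k : ycoord (c *: x) k = c * ycoord x k.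
Proof. exact: (hcoordZ _ _ dotSP). Qed.

Lemma ycoord_sum (I : Type) (s : seq I) (P : pred I) (f : I -> Fs2 mu) k :
  ycoord (\sum_(i <- s | P i) f i) k = \sum_(i <- s | P i) ycoord (f i) k.
Proof. exact: (hcoord_sum _ _ dotSP). Qed.

Lemma ycoord_y k p : ycoord (Fs2_y mu k) p = (k == p)%:R.
Proof. exact: (hcoord_y omega0 dot_yS). Qed.

Lemma ycoord_parseval x :
  l2_mass (fun k => (omega mu k)^-1) (ycoord x) = (hnorm dotS x ^+ 2)%:E.
Proof. exact: (parseval dotSP omega0 dot_yS totalS). Qed.

(** [Fs2_proj] falls back on 0 unless a projection exists. By Bessel the coefficients of [u] have
    finite mass, so they come from some [w] in F_s^2, and [u - w] is orthogonal to every [y^(k)]. *)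
Lemma Fs2_projP (u : Fock) (z : Fs2 mu) : dotF (u - Fs2_proj mu u) z = 0.
Proof.
suff h : [set p : Fs2 mu | forall q : Fs2 mu, dotF (u - p) q = 0] (Fs2_proj mu u) by exact: h.
have coo : (l2_mass (fun k => (omega mu k)^-1)%R (hcoord dotF (y_vec mu) (omega mu) u) < +oo)%E.
  apply: (le_lt_trans (bessel dotFP omega0 (dot_y_vec_y mu) u)); exact: ltry.
have [w wu] := ycoord_lift coo.
apply: (@xgetI _ _ _ w) => /= q; rewrite (dot_conj dotFP).
rewrite [dotF q _](_ : _ = 0) ?conjc0//.
apply: (functional_ext dotSP omega0 dot_yS totalS (L := fun q : Fs2 mu => dotF q (u - w))
  (L' := fun=> 0) (M := hnorm dotF (u - w)) (M' := 0)).
- by move=> c v v'; rewrite -(dotDZl dotFP).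
- by move=> c _ _; rewrite mulr0 addr0.
- by move=> v; rewrite mulrC; exact: (CauchySchwarz dotFP).
- by move=> v; rewrite normc0 mul0r.
move=> k; rewrite (dot_conj dotFP (u - w)) [dotF (u - w) _](_ : _ = 0) ?conjc0//.
rewrite (dotBl dotFP) (dot_hcoord dotF (y_vec mu) omega0) -wu.
by rewrite -[X in X - _](dot_hcoord dotS (Fs2_y mu) omega0) subrr.
Qed.

Lemma ycoord_proj (u : Fock) k :
  ycoord (Fs2_proj mu u) k = hcoord dotF (y_vec mu) (omega mu) u k.
Proof.
have := Fs2_projP u (Fs2_y mu k); rewrite (dotBl dotFP) => /subr0_eq h.
by rewrite /hcoord -[y_vec mu k]/(Fs2_val (Fs2_y mu k)) h.
Qed.

(** Multiplication by the monomial of exponent [k], read on coefficients; the test [mle k p] guards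
    the truncated subtraction in [msub]. *)
Definition shifts_by k T := forall x p,
  ycoord (T x) p = if mle k p then ycoord x (msub p k) else 0.

(** The factor [mu (i :: b)] of the shift cancels the additional factor of
    [suffix_prod mu (i :: b)]. Only words of [Lambda p] beginning with [i] contribute, and they are
    the [i :: b] with [b] in [Lambda (msub p (mdelta i))]. *)
Lemma shifts_by_B i : shifts_by (mdelta i) (B_op mu i).
Proof.
move=> x p; rewrite ycoord_proj hcoord_y_vec.
have gR q : ycoord x q = \sum_(a <- fset_set (Lambda R q)) ((suffix_prod mu a)^-1)%:C * x a.
  by rewrite -hcoord_y_vec.
case: ifP => [ip|/negbT]; last first.
  rewrite mle_mdelta negbK => /eqP pi0.
  rewrite big_seq big1// => -[|j b]; rewrite in_Lambda; first by rewrite mulr0.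
  move=> /eqP /(congr1 (fun p => p i)); rewrite ffunE pi0/=.
  by case: eqP => [->|ji] // _; rewrite ?mulr0//.
rewrite gR.
pose P := [fset i :: b | b in fset_set (Lambda R (msub p (mdelta i)))]%fset.
have pE b : (wcount (i :: b) == p) = (wcount b == msub p (mdelta i)).
  rewrite wcount_cons; apply/eqP/eqP => [<-|->]; first by rewrite maddK.
  exact: msubK.
rewrite -(@big_fset_incl _ _ _ _ P); first last.
- move=> [|j b]; first by rewrite mulr0.
  rewrite in_Lambda /= => jp jP; case: eqP => [ji|_]; last by rewrite mulr0.
  by case/negP: jP; apply/imfsetP; exists b; rewrite ?ji//= in_Lambda -pE -ji.
- apply/fsubsetP => a /imfsetP[b /=]; rewrite in_Lambda => bp ->.
  by rewrite in_Lambda pE.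
rewrite big_imfset/=; last by move=> a b _ _ [].
apply: eq_bigr => b _; rewrite eqxx mulrA -real_complexM; congr (_%:C * _).
by field; rewrite !gt_eqF ?suffix_prod_gt0// weight_gt0.
Qed.

Lemma shifts_by_comp k p T S : shifts_by k T -> shifts_by p S -> shifts_by (madd k p) (T \o S).
Proof.
move=> Tk Sp x q; rewrite /= Tk Sp.
have -> : mle (madd k p) q = mle k q && mle p (msub q k).
  apply/forallP/andP => [h|[/forallP h /forallP h'] j].
    split; apply/forallP => j; have := h j; rewrite !ffunE; first exact: leq_trans (leq_addr _ _).
    by move=> hj; rewrite leq_subRL// (leq_trans (leq_addr _ _) hj).
  by have := h' j; rewrite !ffunE leq_subRL.
have -> : msub q (madd k p) = msub (msub q k) p.
  by apply/ffunP => j; rewrite !ffunE subnDA.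
by case: (mle k q).
Qed.

Lemma shifts_by_id : shifts_by (mzero n) id.
Proof.
move=> x p; have -> : mle (mzero n) p by apply/forallP => j; rewrite ffunE.
by congr ycoord; apply/ffunP => j; rewrite !ffunE subn0.
Qed.

Lemma shifts_by_Bpow k : shifts_by k (Bpow mu k).
Proof.
have it i m : shifts_by [ffun j => (m * (j == i))%N] (iter m (B_op mu i)).
  elim: m => [|m IH].
    rewrite (_ : finfun _ = mzero n); first exact: shifts_by_id.
    by apply/ffunP => j; rewrite !ffunE.
  rewrite (_ : finfun _ = madd (mdelta i) [ffun j => (m * (j == i))%N]); last first.
    by apply/ffunP => j; rewrite !ffunE mulSn.
  exact: shifts_by_comp (shifts_by_B i) IH.
rewrite /Bpow.
(* Generalized to any list of indices, repetitions included, so that induction on the list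
   applies. *)
have h (r : seq 'I_n) : shifts_by [ffun j => (k j * count_mem j r)%N]
    (\big[(fun S T => S \o T)/id]_(i <- r) iter (k i) (B_op mu i)).
  elim: r => [|i r IH].
    rewrite big_nil (_ : finfun _ = mzero n); first exact: shifts_by_id.
    by apply/ffunP => j; rewrite !ffunE muln0.
  rewrite big_cons (_ : finfun _ =
      madd [ffun j => (k i * (j == i))%N] [ffun j => (k j * count_mem j r)%N]).
    exact: (shifts_by_comp (it i (k i)) IH).
  apply/ffunP => j; rewrite !ffunE/= mulnDr eq_sym.
  by case: eqP => [->|_] //=; rewrite !muln0.
have := h (index_enum 'I_n); rewrite (_ : finfun _ = k)//.
apply/ffunP => j; rewrite !ffunE count_uniq_mem ?index_enum_uniq// mem_index_enum.
by rewrite muln1.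
Qed.

Lemma shifts_by_unique k T S : shifts_by k T -> shifts_by k S -> T = S.
Proof. by move=> Tk Sk; apply/funext => x; apply/ycoord_inj/funext => p; rewrite Tk Sk. Qed.

Lemma shifts_by_linear k T : shifts_by k T -> linear T.
Proof.
move=> Tk c x z; apply/ycoord_inj/funext => p; rewrite Tk !ycoordZD !Tk.
by case: ifP => // _; rewrite mulr0 addr0.
Qed.

Lemma shifts_by_y k T p : shifts_by k T -> T (Fs2_y mu p) = Fs2_y mu (madd p k).
Proof.
move=> Tk; apply/ycoord_inj/funext => q; rewrite Tk !ycoord_y.
case: ifP => kq.
  suff -> : (p == msub q k) = (madd p k == q) by [].
  by apply/eqP/eqP => [->|<-]; rewrite ?msubK ?maddK.
suff -> : (madd p k == q) = false by [].
by apply/eqP => pq; rewrite -pq mle_madd in kq.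
Qed.

Lemma vacuumE : vacuum mu = Fs2_y mu (mzero n).
Proof.
by apply: val_inj; rewrite /= -(y_vec0 mu).
Qed.

Definition B_commutant : set (Fs2 mu -> Fs2 mu) :=
  [set T | bounded_op dotS T /\ forall i x, T (B_op mu i x) = B_op mu i (T x)].

Lemma commute_Bpow T k x : (forall i x, T (B_op mu i x) = B_op mu i (T x)) ->
  T (Bpow mu k x) = Bpow mu k (T x).
Proof.
move=> TB; rewrite /Bpow; elim: (index_enum _) x => [|i r IH] x; first by rewrite big_nil.
rewrite big_cons /= -IH; elim: (k i) => [//|m IHm] /=.
by rewrite TB IHm.
Qed.

(** Since [y^(k)] is [B^k] applied to the vacuum, the image of the vacuum determines the images of
    all [y^(k)]. *)
Lemma commute_y T k : (forall i x, T (B_op mu i x) = B_op mu i (T x)) ->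
  T (Fs2_y mu k) = Bpow mu k (T (vacuum mu)).
Proof.
move=> TB; rewrite -commute_Bpow// vacuumE (shifts_by_y _ (@shifts_by_Bpow k)).
by rewrite maddC madd0.
Qed.

End compressed_shifts.

(** * Automatic boundedness of triangular operators *)

Section triangular_operators.
Variables (R : realType) (n : nat) (mu : weights R n).
Local Notation C := R[i].
Local Notation multiindex := (multiindex n).
Local Notation dotS := (Fs2_dot mu).
Local Notation norm := (hnorm dotS).
Implicit Types (k p q : multiindex) (x z u v : Fs2 mu) (T S : Fs2 mu -> Fs2 mu).
Let dotSP := Fs2_inner_product mu.
Let omega0 := omega_gt0 mu.
Let dot_yS := Fs2_dot_y mu.
Let totalS := @Fs2_total R n mu.

Definition vanishes_to (m : nat) x := forall k, (mdegree k <= m)%N -> ycoord x k = 0.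

(** Purely algebraic; continuity is a consequence, see [triangular_bounded]. *)
Definition triangular T := linear T /\ forall m x, vanishes_to m x -> vanishes_to m (T x).

Definition degree_le m : {fset multiindex} := fset_set [set k | (mdegree k <= m)%N].

Lemma in_degree_le m k : (k \in degree_le m) = (mdegree k <= m)%N.
Proof.
rewrite in_fset_set; last exact: finite_mdegree_le.
by apply/idP/idP; rewrite inE.
Qed.

Local Notation Q m := (hproj dotS (Fs2_y mu) (omega mu) (degree_le m)).

Lemma ycoord_Q m x k : ycoord (Q m x) k = if (mdegree k <= m)%N then ycoord x k else 0.
Proof. by rewrite /ycoord (hcoord_hproj dotSP omega0 dot_yS) in_degree_le. Qed.

Lemma vanishes_subQ m x : vanishes_to m (x - Q m x).
Proof. by move=> k km; rewrite ycoordB ycoord_Q km subrr. Qed.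

Lemma Q_vanishes m x : vanishes_to m x -> Q m x = 0.
Proof.
move=> xm; apply/ycoord_inj/funext => k; rewrite ycoord_Q ycoord0.
by case: ifP => // /xm.
Qed.

Lemma Q_cvg x (e : R) : 0 < e -> exists m0, forall m, (m0 <= m)%N -> norm (x - Q m x) < e.
Proof.
move=> /(hexpansionP dotSP omega0 dot_yS totalS x)[F0 h].
exists (\max_(k <- F0) mdegree k) => m hm; apply: h.
apply/fsubsetP => k kF; rewrite in_degree_le; apply: leq_trans hm.
exact: leq_bigmax_seq.
Qed.

Lemma hnorm_ycoord_le x k : normc (ycoord x k) <= omega mu k * norm (Fs2_y mu k) * norm x.
Proof.
rewrite normcM normc_real ?(ltW (omega0 k))// -mulrA ler_wpM2l ?(ltW (omega0 k))//.
by rewrite mulrC; exact: (CauchySchwarz dotSP).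
Qed.

Lemma hnorm_sum (I : Type) (s : seq I) (f : I -> Fs2 mu) :
  norm (\sum_(i <- s) f i) <= \sum_(i <- s) norm (f i).
Proof.
elim/big_rec2: _ => [|i y x _ h]; first by rewrite (hnorm0 dotSP).
by apply: le_trans (hnormD dotSP _ _) _; rewrite lerD2l.
Qed.

(** [Q m] has finite rank, so even a discontinuous [T] is bounded on its range. *)
Lemma bounded_on_Q T m : linear T -> exists2 c : R, 0 <= c &
  forall x, norm (T (Q m x)) <= c * norm x.
Proof.
move=> Tl.
exists (\sum_(k <- degree_le m) omega mu k * norm (Fs2_y mu k) * norm (T (Fs2_y mu k))).
  by apply: sumr_ge0 => k _; rewrite !mulr_ge0 ?hnorm_ge0// ltW.
move=> x; rewrite linear_fun_sum//; apply: le_trans (hnorm_sum _ _) _.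
rewrite mulr_suml; apply: ler_sum => k _.
rewrite linear_funZ// (hnormZ dotSP) mulrAC ler_wpM2r ?hnorm_ge0//.
exact: hnorm_ycoord_le.
Qed.

Lemma hump T (s : Fs2 mu) (m : nat) (N d : R) : triangular T -> ~ bounded_op dotS T -> 0 < d ->
  exists um : Fs2 mu * nat, [/\ vanishes_to m um.1, norm um.1 <= d, (m < um.2)%N &
    N < norm (Q um.2 (T (s + um.1)))].
Proof.
move=> [Tl Tt] Tub d0; have [c c0 Tc] := bounded_on_Q m Tl.
(* The term [norm (T s)] pays for adding [s], the term 1 for the final truncation by [Q]. *)
pose B := `|N| + norm (T s) + 1.
have B0 : 0 < B by rewrite ltr_wpDl// addr_ge0 ?hnorm_ge0.
(* The constant [c] absorbs the low degree part [T (Q m v)]; the rest [v'] still violates the bound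
   [B / d] and, rescaled to norm [d], has an image of norm above [B]. *)
have [v vT] : exists v, (c + B / d) * norm v < norm (T v).
  apply: contrapT => h; apply: Tub; split=> //; exists (c + B / d) => v.
  by rewrite leNgt; apply/negP => hv; apply: h; exists v.
pose v' := v - Q m v.
have v'v : norm v' <= norm v.
  rewrite -ler_sqr ?nnegrE ?hnorm_ge0// (hnorm_hproj_pythag dotSP omega0 dot_yS (degree_le m) v).
  by rewrite lerDr sqr_ge0.
have Bd0 : 0 < B / d by rewrite divr_gt0.
have Tv' : B / d * norm v' < norm (T v').
  have : norm (T v) <= norm (T v') + norm (T (Q m v)).
    rewrite {1}(_ : T v = T v' + T (Q m v)) ?(hnormD dotSP)//.
    by rewrite -linear_funD// subrK.
  have := Tc v; have : B / d * norm v' <= B / d * norm v by rewrite ler_wpM2l// ltW.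
  by rewrite mulrDl in vT; lra.
have v'0 : 0 < norm v'.
  rewrite lt_neqAle hnorm_ge0 andbT; apply/eqP => /esym v'0.
  by move: Tv'; rewrite v'0 (hnorm_eq0 dotSP v'0) linear_fun0// (hnorm0 dotSP) mulr0 ltxx.
pose u := (d / norm v')%:C *: v'.
have nu : norm u = d by rewrite (hnormZ dotSP) normc_real ?divr_ge0 ?ltW// divfK// gt_eqF.
have um : vanishes_to m u by move=> k km; rewrite ycoordZ vanishes_subQ// mulr0.
have nTu : B < norm (T u).
  rewrite linear_funZ// (hnormZ dotSP) normc_real ?divr_ge0 ?ltW//.
  by rewrite mulrAC ltr_pdivlMr// [d * _]mulrC -ltr_pdivrMr// mulrAC.
have nTsu : `|N| + 1 < norm (T (s + u)).
  have : norm (T u) <= norm (T (s + u)) + norm (T s).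
    rewrite {1}(_ : T u = T (s + u) + - T s) ?linear_funD//; last first.
      by rewrite addrAC subrr add0r.
    by apply: le_trans (hnormD dotSP _ _) _; rewrite (hnormN dotSP).
  by rewrite /B in nTu; lra.
have [m0 hm0] := Q_cvg (T (s + u)) (@ltr01 R).
exists (u, maxn m0 m.+1); split => //=; [by rewrite nu|exact: leq_maxr|].
have := hm0 _ (leq_maxl m0 m.+1); move: (T (s + u)) nTsu => w nTsu hw.
have : norm w <= norm (w - Q (maxn m0 m.+1) w) + norm (Q (maxn m0 m.+1) w).
  by rewrite -{1}[w](subrK (Q (maxn m0 m.+1) w)) (hnormD dotSP).
have := ler_norm N; move: nTsu hw.
by move: (norm w) (norm (w - _)) (norm (Q _ w)) `|N| => a b c' N'; lra.
Qed.

Lemma hump_sequence T : triangular T -> ~ bounded_op dotS T ->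
  exists (s : nat -> Fs2 mu) (m : nat -> nat), forall j,
    [/\ vanishes_to (m j) (s j.+1 - s j), norm (s j) <= 2,
        (m j < m j.+1)%N & j%:R < norm (Q (m j.+1) (T (s j.+1)))].
Proof.
move=> Tt Tub.
have d0 j : 0 < (2 ^+ j)^-1 :> R by rewrite invr_gt0 exprn_gt0.
pose step j (sm : Fs2 mu * nat) :=
  let um := sval (cid (hump sm.1 sm.2 j%:R Tt Tub (d0 j))) in (sm.1 + um.1, um.2).
pose st := fix st j := if j is i.+1 then step i (st i) else (0, 0%N).
exists (fun j => (st j).1), (fun j => (st j).2) => j.
have stP i : [/\ vanishes_to (st i).2 ((st i.+1).1 - (st i).1),
    norm ((st i.+1).1 - (st i).1) <= (2 ^+ i)^-1, ((st i).2 < (st i.+1).2)%N &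
    i%:R < norm (Q (st i.+1).2 (T (st i.+1).1))].
  rewrite [st i.+1]/(step i (st i)) /step /=.
  case: cid => um /= [h1 h2 h3 h4]; by rewrite addrC addKr; split.
have [h1 h2 h3 h4] := stP j; split => //.
(* The geometric sum of the bounds [1 / 2 ^+ i] on the bumps with [i < j]. *)
have hn : norm (st j).1 <= 2 - 2 / 2 ^+ j.
  elim: {h1 h2 h3 h4}j => [|j IH]; first by rewrite expr0 divr1 subrr (hnorm0 dotSP).
  have [_ h _ _] := stP j.
  rewrite -[(st j.+1).1](subrK (st j).1); apply: le_trans (hnormD dotSP _ _) _.
  apply: le_trans (lerD h IH) _; rewrite exprS invfM mulrA divff// mul1r.
  by rewrite le_eqVlt; apply/orP; left; apply/eqP; ring.
by apply: le_trans hn _; rewrite lerBlDr lerDl divr_ge0// exprn_ge0.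
Qed.

(* A gliding hump whose bumps vanish to increasing order; triangularity keeps
   later bumps from disturbing the low coordinates of the earlier images. *)
Lemma triangular_bounded T : triangular T -> bounded_op dotS T.
Proof.
move=> Tt; apply: contrapT => Tub; have [s [m sm]] := hump_sequence Tt Tub.
have mj j : (j <= m j)%N.
  by elim: j => // j IH; have [_ _ h _] := sm j; exact: leq_ltn_trans h.
have mle i j : (i <= j)%N -> (m i <= m j)%N.
  move=> /subnK <-; elim: (j - i)%N => // d IH; have [_ _ h _] := sm (d + i)%N.
  exact/(leq_trans IH)/ltnW.
have ss i j k : (i <= j)%N -> (mdegree k <= m i)%N -> ycoord (s j) k = ycoord (s i) k.
  move=> /subnK <- km; elim: (j - i)%N => // d IH; have [h _ _ _] := sm (d + i)%N.
  rewrite -IH; apply/subr0_eq; rewrite -ycoordB; apply: h.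
  exact: leq_trans km (mle _ _ (leq_addl _ _)).
(* The coordinate at [k] is constant from any stage [j] with [mdegree k <= m j] on; stage
   [mdegree k] is one, as [j <= m j]. *)
pose c k := ycoord (s (mdegree k)) k.
have cE j k : (mdegree k <= m j)%N -> c k = ycoord (s j) k.
  move=> km; case/orP: (leq_total (mdegree k) j) => kj.
    by rewrite (ss _ _ _ kj).
  by rewrite /c (ss _ _ _ kj).
have coo : (l2_mass (fun k => (omega mu k)^-1)%R c < +oo)%E.
  apply: (@le_lt_trans _ _ 4%:E); last exact: ltry.
  apply: ge_ereal_sup => _ [A [finA _] <-].
  pose j := (\max_(k <- fset_set A) mdegree k)%N.
  have [_ sj _ _] := sm j.
  apply: (@le_trans _ _ (norm (s j) ^+ 2)%:E%R).
    rewrite -ycoord_parseval; apply: ereal_sup_ubound; exists A => //.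
    rewrite !fsbig_finite//=; rewrite big_seq [RHS]big_seq; apply: eq_bigr => k kA.
    rewrite (cE j)//; apply: leq_trans (mj j); exact: leq_bigmax_seq.
  by rewrite lee_fin (_ : 4 = 2 ^+ 2) ?ler_sqr ?nnegrE ?hnorm_ge0// expr2 -natrM.
have [x xc] := ycoord_lift coo.
have [Tl Tv] := Tt.
(* The difference of [x] and [s j.+1] vanishes to order [m j.+1], so their images agree under
   [Q (m j.+1)]. *)
have big j : j%:R < norm (T x).
  have [_ _ _ h] := sm j; apply: lt_le_trans h _.
  rewrite (_ : Q _ _ = Q (m j.+1) (T x)).
    exact: (hnorm_hproj_le dotSP omega0 dot_yS).
  apply/esym/subr0_eq; rewrite -(hprojB _ _ dotSP) -linear_funB//.
  apply/Q_vanishes/Tv => k km; rewrite ycoordB xc (cE j.+1)// subrr.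
  by [].
have := big (Num.bound (norm (T x))); apply/negP; rewrite -leNgt.
by rewrite ltW// archi_boundP// hnorm_ge0.
Qed.

Lemma shifts_by_triangular k T : shifts_by k T -> triangular T.
Proof.
move=> Tk; split; first exact: shifts_by_linear Tk.
move=> m x xm p pm; rewrite Tk; case: ifP => // kp; apply: xm.
by apply: leq_trans pm; rewrite -[in leqRHS](msubK kp) mdegreeD leq_addr.
Qed.

(** The continuity of the shifts is another instance of the gliding hump. *)
Lemma shifts_by_bounded k T : shifts_by k T -> bounded_op dotS T.
Proof. by move=> /shifts_by_triangular; exact: triangular_bounded. Qed.

End triangular_operators.

(** * Evaluation at the points of the domain *)

Section point_evaluations.
Variables (R : realType) (n : nat) (mu : weights R n).
Local Notation C := R[i].
Local Notation multiindex := (multiindex n).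
Local Notation Fock := (l2 R (word n)).
Local Notation dotF := (@l2_dot R (word n)).
Local Notation dotS := (Fs2_dot mu).
Local Notation norm := (hnorm dotS).
Local Notation point := 'rV[R[i]^o]_n.
Local Notation D := (set_type (Ddomain mu)).
Implicit Types (k p q : multiindex) (x z u v : Fs2 mu) (l : D).
Let dotFP := l2_inner_product R (word n).
Let dotSP := Fs2_inner_product mu.
Let omega0 := omega_gt0 mu.
Let dot_yS := Fs2_dot_y mu.
Let totalS := @Fs2_total R n mu.

(** The reproducing kernel at [l], as a vector of the full Fock space: square summability of this
    family is exactly membership of [l] in [Ddomain mu]. The conjugate offsets the conjugate
    linearity of [l2_dot] in its second argument. *)
Definition kernel_fun (l : point) (a : word n) : C :=
  conjc (word_monomial l a) * ((suffix_prod mu a)^-1)%:C.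

Lemma kernel_fun_sqr (l : point) a : 1 * normc (kernel_fun l a) ^+ 2 =
  normc (word_monomial l a) ^+ 2 / suffix_prod mu a ^+ 2.
Proof.
rewrite mul1r normcM normc_conj normc_real ?exprMn ?exprVn//.
by rewrite invr_ge0 ltW// suffix_prod_gt0.
Qed.

Lemma kernel_funP l : kernel_fun (val l) \in @l2_pred R (word n).
Proof.
rewrite inE /l2_set/=; apply: le_lt_trans (set_valP l).
by apply: le_esum => a _; rewrite kernel_fun_sqr.
Qed.

Definition kernel l : Fock := L2 (kernel_funP l).

Definition eval x l : C := dotF x (kernel l).

Lemma eval_y k l : eval (Fs2_y mu k) l = monomial (val l) k.
Proof.
rewrite /eval (dot_conj dotFP) dot_y_vec conjcM conjc_real.
rewrite [X in _ * conjc X](_ : _ = conjc (monomial (val l) k) * (omega mu k)%:C).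
  rewrite conjcM conjcK conjc_real mulrCA -real_complexM mulVf ?mulr1//.
  by rewrite gt_eqF ?omega_gt0.
rewrite omegaE (rmorph_sum (real_complex R)) mulr_sumr big_seq [RHS]big_seq.
apply: eq_bigr => a; rewrite in_Lambda => /eqP <- /=.
rewrite /kernel_fun word_monomialE mulrCA -real_complexM; congr (_ * _%:C).
by rewrite -invfM.
Qed.

Lemma evalZD (c : C) x z l : eval (c *: x + z) l = c * eval x l + eval z l.
Proof. exact: (dotDZl dotFP). Qed.

Lemma evalB x z l : eval (x - z) l = eval x l - eval z l.
Proof. exact: (dotBl dotFP). Qed.

Lemma evalZ (c : C) x l : eval (c *: x) l = c * eval x l.
Proof. exact: (dotZl dotFP). Qed.

Lemma eval0 l : eval 0 l = 0.
Proof. exact: (dot0l dotFP). Qed.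

Lemma eval_le x l : normc (eval x l) <= hnorm dotF (kernel l) * norm x.
Proof. by rewrite mulrC; exact: (CauchySchwarz dotFP). Qed.

Lemma has_csum_eval x l : has_csum (fun k => ycoord x k * monomial (val l) k) (eval x l).
Proof.
have := has_hsum_functional (L := eval^~ l) _ (fun u => eval_le u l)
  (hexpansion dotSP omega0 dot_yS totalS x).
rewrite [X in has_csum X](_ : _ = fun k => ycoord x k * monomial (val l) k).
  by apply=> c u v; exact: evalZD.
by apply/funext => k; rewrite evalZ eval_y.
Qed.

Lemma power_series_eval x : power_series (eval x) (ycoord x).
Proof. by split; [rewrite ycoord_parseval ltry|exact: has_csum_eval]. Qed.

(** The coefficients have finite mass, so they are the coordinates of a vector, whose evaluation is
    the same sum. *)
Lemma power_seriesP (phi : D -> C) c : power_series phi c ->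
  exists2 x, eval x = phi & ycoord x = c.
Proof.
move=> [coo cphi]; have [x xc] := ycoord_lift coo; exists x => //.
apply/funext => l; apply: has_csum_inj (cphi l).
by rewrite -xc; exact: has_csum_eval.
Qed.

Lemma eval_B i x l : eval (B_op mu i x) l = val l ord0 i * eval x l.
Proof.
have [Bl _] := shifts_by_bounded (@shifts_by_B _ _ mu i).
have [M _ BM] := bounded_opP (shifts_by_bounded (@shifts_by_B _ _ mu i)).
apply: (functional_ext dotSP omega0 dot_yS totalS (L := fun x => eval (B_op mu i x) l)
  (L' := fun x => val l ord0 i * eval x l) (M := hnorm dotF (kernel l) * M)
  (M' := normc (val l ord0 i) * hnorm dotF (kernel l))).
- by move=> c u v; rewrite Bl evalZD.
- by move=> c u v; rewrite evalZD mulrDr mulrCA.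
- move=> v; apply: le_trans (eval_le _ _) _.
  by rewrite -mulrA ler_wpM2l ?hnorm_ge0.
- by move=> v; rewrite normcM -mulrA ler_wpM2l ?normc_ge0// eval_le.
move=> k; rewrite (shifts_by_y k (@shifts_by_B _ _ mu i)) !eval_y monomialD.
by rewrite monomial_mdelta mulrC.
Qed.

Lemma eval_Bpow k x l : eval (Bpow mu k x) l = monomial (val l) k * eval x l.
Proof.
rewrite /Bpow /monomial; elim: (index_enum _) => [|i r IH]; first by rewrite !big_nil mul1r.
rewrite !big_cons /= -mulrA -IH; elim: (k i) => [|m IHm] /=; first by rewrite expr0 mul1r.
by rewrite eval_B IHm exprS mulrA.
Qed.

End point_evaluations.

(** * Weighted degrees with a unique least term *)

Lemma digits_inj (b n : nat) (f g : 'I_n -> nat) :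
  (forall i, (f i < b)%N) -> (forall i, (g i < b)%N) ->
  (\sum_(i < n) f i * b ^ i = \sum_(i < n) g i * b ^ i)%N -> f =1 g.
Proof.
elim: n f g => [|n IH] f g fb gb; first by move=> _ [].
rewrite !big_ord_recl !expn0 !muln1.
have E (h : 'I_n.+1 -> nat) : (\sum_(i < n) h (lift ord0 i) * b ^ lift ord0 i =
    (\sum_(i < n) h (lift ord0 i) * b ^ i) * b)%N.
  by rewrite big_distrl; apply: eq_bigr => i _ /=; rewrite -mulnA -expnSr.
have b0 : (0 < b)%N by apply: leq_ltn_trans (fb ord0).
rewrite !E => h.
have f0 : f ord0 = g ord0.
  have := congr1 (modn^~ b) h; rewrite /= !(addnC _ (_ * b)%N) !modnMDl.
  by rewrite !modn_small.
move: h; rewrite f0 => /addnI /eqP; rewrite eqn_pmul2r// => /eqP h i.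
have [->|[j ->]] : i = ord0 \/ exists j, i = lift ord0 j.
  by case: (unliftP ord0 i) => [j|] ->; [right; exists j|left].
  exact: f0.
by apply: (IH (fun i => f (lift ord0 i)) (fun i => g (lift ord0 i)) _ _ h j) => i'.
Qed.

Section weighted_degree.
Variable n : nat.
Local Notation multiindex := (multiindex n).
Implicit Types (k p : multiindex).

Definition wdegree (d : 'I_n -> nat) k := (\sum_(i < n) d i * k i)%N.

(* The weights [L + (m' + 1) ^ i], with [m'] the least degree in the support and
   [L] large, refine the ordinary degree and separate the multi-indices of degree
   [m'] by their expansions in base [m' + 1]. *)
Lemma leading_weights (P : multiindex -> Prop) m : (exists2 k, P k & (mdegree k <= m)%N) ->
  exists (L : nat) (d : 'I_n -> nat) p, [/\ P p, (wdegree d p < L * m.+1)%N,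
    forall k, P k -> k <> p -> (wdegree d p < wdegree d k)%N &
    forall k, (L * mdegree k <= wdegree d k)%N].
Proof.
move=> [k0 Pk0 k0m].
have ex1 : exists j, `[< exists2 k, P k & mdegree k = j >].
  by exists (mdegree k0); apply/asboolP; exists k0.
case: (ex_minnP ex1) => m' /asboolP[k1 Pk1 k1m'] minm'.
have m'm : (m' <= m)%N by apply: leq_trans k0m; apply: minm'; apply/asboolP; exists k0.
have Pm' k : P k -> (m' <= mdegree k)%N by move=> Pk; apply: minm'; apply/asboolP; exists k.
(* Exponents of a multi-index of degree [m'] are below [b], hence are digits. [L] exceeds the sum of
   the [k i * b ^ i] in degree [m'], so degree [m'] has smaller weight than all higher degrees. *)
pose b := m'.+1; pose L := (m' * b ^ n).+1; pose d (i : 'I_n) := (L + b ^ i)%N.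
have dE k : wdegree d k = (L * mdegree k + \sum_(i < n) k i * b ^ i)%N.
  rewrite /wdegree /mdegree big_distrr -big_split; apply: eq_bigr => i _ /=.
  by rewrite /d mulnDl [(b ^ i * _)%N]mulnC.
have dL k : (L * mdegree k <= wdegree d k)%N by rewrite dE leq_addr.
have dU k : mdegree k = m' -> (wdegree d k < L * m'.+1)%N.
  move=> km; rewrite dE km mulnS addnC ltn_add2r ltnS -km /mdegree big_distrl.
  by apply: leq_sum => i _; rewrite leq_mul2l leq_pexp2l ?orbT// ltnW.
have inj k k' : mdegree k = m' -> mdegree k' = m' -> wdegree d k = wdegree d k' -> k = k'.
  move=> km km'; rewrite !dE km km' => /addnI h; apply/ffunP.
  by apply: (digits_inj _ _ h) => i; rewrite ltnS -?km -?km' ?mdegree_ge// km -km' mdegree_ge.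
(* The leading term: least weight among the multi-indices of [P] of least degree, attained once by
   [inj]. *)
have ex2 : exists w, `[< exists k, [/\ P k, mdegree k = m' & wdegree d k = w] >].
  by exists (wdegree d k1); apply/asboolP; exists k1.
case: (ex_minnP ex2) => w /asboolP[p [Pp pm' pw]] minw.
exists L, d, p; split => //.
  by apply: leq_trans (dU p pm') _; rewrite leq_mul2l ltnS m'm orbT.
move=> k Pk kp; have := Pm' _ Pk; rewrite leq_eqVlt => /predU1P[/esym km'|km'].
  rewrite ltn_neqAle; apply/andP; split.
    by apply/eqP => h; apply: kp; apply: inj.
  by rewrite pw; apply: minw; apply/asboolP; exists k.
apply: leq_trans (dU p pm') _; apply: leq_trans (dL k).
by rewrite leq_mul2l km' orbT.
Qed.

End weighted_degree.

(** * Order of vanishing at the origin *)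

Section vanishing.
Variables (R : realType) (n : nat) (mu : weights R n).
Local Notation C := R[i].
Local Notation multiindex := (multiindex n).
Local Notation dotF := (@l2_dot R (word n)).
Local Notation dotS := (Fs2_dot mu).
Local Notation norm := (hnorm dotS).
Local Notation point := 'rV[R[i]^o]_n.
Local Notation D := (set_type (Ddomain mu)).
Implicit Types (k p q : multiindex) (x z u v : Fs2 mu).
Hypothesis D_nbhs : nbhs (0 : point) (Ddomain mu).
Let dotSP := Fs2_inner_product mu.
Let omega0 := omega_gt0 mu.
Let dot_yS := Fs2_dot_y mu.
Let totalS := @Fs2_total R n mu.

Lemma Ddomain_box : exists2 s : R, 0 < s &
  forall l : point, (forall i, normc (l ord0 i) <= s) -> Ddomain mu l.
Proof.
have /nbhs_ballP[e /= e0 eD] := D_nbhs.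
have eE : e = (complex.Re e)%:C by rewrite RRe_real// gtr0_real.
have Re0 : 0 < complex.Re e by rewrite eE ltcR in e0.
exists (complex.Re e / 2); first by rewrite divr_gt0.
move=> l ls; apply: eD; split=> // i j; rewrite ord1 -ball_normE /= mxE sub0r normrN.
rewrite norm_normc eE ltcR; apply: le_lt_trans (ls j) _.
by rewrite ltr_pdivrMr// ltr_pMr// ltr1n.
Qed.

Definition curve (s : R) (d : 'I_n -> nat) (t : R) : point := \row_i (s * t ^+ d i)%:C.

Lemma monomial_curve s d t k :
  monomial (curve s d t) k = (s ^+ mdegree k * t ^+ wdegree d k)%:C.
Proof.
rewrite /monomial (_ : s ^+ _ * _ = \prod_(i < n) (s * t ^+ d i) ^+ k i).
  rewrite (rmorph_prod (real_complex R)); apply: eq_bigr => i _.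
  by rewrite mxE (rmorphXn (real_complex R)).
rewrite /mdegree /wdegree -!prodrXr -big_split; apply: eq_bigr => i _.
by rewrite exprMn exprM.
Qed.

Section along_a_curve.
Variables (s : R) (d : 'I_n -> nat).
Hypothesis s_gt0 : 0 < s.
Hypothesis curveD : forall t, 0 <= t <= 1 -> Ddomain mu (curve s d t).

Definition curve_point t (t01 : 0 <= t <= 1) : D := SigSub (mem_set (curveD t01)).

(** With [t ^+ W] factored out, the remaining coefficients are dominated by those of [x]. They
    belong to a vector [z] of norm at most [norm x], evaluated at the end point [t = 1], so the
    constant does not depend on [t]. *)
Lemma eval_curve_le x W : (forall k, (wdegree d k < W)%N -> ycoord x k = 0) ->
  exists2 c : R, 0 <= c &
    forall t (t01 : 0 <= t <= 1), normc (eval x (curve_point t01)) <= c * t ^+ W.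
Proof.
move=> xW; have h11 : 0 <= (1 : R) <= 1 by rewrite ler01 lexx.
exists (hnorm dotF (kernel (curve_point h11)) * norm x); first by rewrite mulr_ge0 ?hnorm_ge0.
move=> t t01; have /andP[t0 t1] := t01.
(* Where the subtraction truncates, the coordinate of [x] is 0. *)
pose c k := ycoord x k * (t ^+ (wdegree d k - W))%:C.
have cx k : normc (c k) <= normc (ycoord x k).
  rewrite normcM normc_real ?exprn_ge0// ler_piMr ?normc_ge0//.
  exact: exprn_ile1.
have coo : (l2_mass (fun k => (omega mu k)^-1)%R c < +oo)%E.
  apply: (@le_lt_trans _ _ (norm x ^+ 2)%:E%R); last exact: ltry.
  rewrite -ycoord_parseval; apply: le_esum => k _; rewrite lee_fin.
  by rewrite ler_wpM2l ?invr_ge0 ?(ltW (omega0 k))// ler_sqr ?nnegrE ?normc_ge0.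
have [z zc] := ycoord_lift coo.
have zx : norm z <= norm x.
  apply: (hcoord_norm_le dotSP omega0 dot_yS totalS) => k.
  by rewrite -!/(ycoord _ k) zc.
have -> : eval x (curve_point t01) = (t ^+ W)%:C * eval z (curve_point h11).
  apply: has_csum_inj (has_csum_eval (x := x) (l := _)) _.
  have := has_csumZ (a := (t ^+ W)%:C) (has_csum_eval (x := z) (l := curve_point h11)).
  congr has_csum; apply/funext => k; rewrite zc /c /= !monomial_curve expr1n mulr1.
  case: (ltnP (wdegree d k) W) => [kW|Wk]; first by rewrite xW// !mul0r mulr0.
  rewrite -mulrA mulrCA; congr (_ * _); rewrite -!real_complexM; congr (_%:C).
  by rewrite mulrA -exprD subnKC// mulrC.
rewrite normcM normc_real ?exprn_ge0// mulrC ler_wpM2r ?exprn_ge0//.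
by apply: le_trans (eval_le _ _) _; rewrite ler_wpM2l ?hnorm_ge0.
Qed.

(** Without its term at [p], [z] decays like [t ^+ (wdegree d p).+1], as [z] itself does by
    assumption. The term at [p] alone is of order [t ^+ wdegree d p]; dividing by this power and
    letting [t] tend to 0 leaves a zero coefficient. *)
Lemma leading_coef_eq0 z p c :
  (forall k, ycoord z k <> 0 -> k <> p -> (wdegree d p < wdegree d k)%N) ->
  (forall t (t01 : 0 <= t <= 1),
     normc (eval z (curve_point t01)) <= c * t ^+ (wdegree d p).+1) ->
  ycoord z p = 0.
Proof.
move=> zp zc; set a := ycoord z p.
have z'0 k : (wdegree d k < (wdegree d p).+1)%N -> ycoord (z - a *: Fs2_y mu p) k = 0.
  move=> kp; rewrite ycoordB ycoordZ ycoord_y.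
  case: eqP => [<-|/nesym pk]; first by rewrite mulr1 subrr.
  rewrite mulr0 subr0; apply: contrapT => zk.
  by have := zp k zk pk; rewrite ltnNge -ltnS kp.
have [c' c'0 hc'] := eval_curve_le z'0.
have h t : 0 < t <= 1 -> normc a * s ^+ mdegree p <= (c + c') * t.
  move=> /andP[t0 t1]; have t01 : 0 <= t <= 1 by rewrite ltW.
  have := zc t t01; have := hc' t t01.
  rewrite evalB evalZ eval_y /= monomial_curve.
  set e := eval z _; set b := a * _ => h1 h2.
  have hb : normc b <= normc e + normc (e - b).
    rewrite -{1}(subKr e b); apply: le_trans (le_normcD _ _) _.
    by rewrite normcN.
  have : normc b <= (c + c') * t ^+ (wdegree d p).+1 by rewrite mulrDl; lra.
  rewrite /b normcM normc_real; last by rewrite mulr_ge0 ?exprn_ge0 ?ltW.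
  by rewrite exprS !mulrA ler_pM2r// exprn_gt0.
apply: eq0_normc; apply/eqP; rewrite eq_le normc_ge0 andbT.
have sp : 0 < s ^+ mdegree p by rewrite exprn_gt0.
rewrite -(ler_pM2r sp) mul0r; apply/ler_addgt0Pr => e e0; rewrite add0r.
pose M := `|c + c'| + 1; have M0 : 0 < M by rewrite ltr_wpDl.
have t0 : 0 < Num.min 1 (e / M) by rewrite lt_min ltr01 divr_gt0.
apply: le_trans (h (Num.min 1 (e / M)) _) _; first by rewrite t0 ge_min lexx.
apply: (@le_trans _ _ (M * (e / M))); last by rewrite mulrC divfK// gt_eqF.
apply: (@le_trans _ _ (M * Num.min 1 (e / M))).
  by rewrite ler_wpM2r ?(ltW t0)// (le_trans (ler_norm _))// lerDl.
by rewrite ler_wpM2l ?(ltW M0)// ge_min lexx orbT.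
Qed.

End along_a_curve.

(* Along the curve [l_i = s t^(d i)] the least weighted degree in the support of
   [z] governs the decay of [eval z] as [t] tends to 0. *)
Lemma vanishes_to_product u z x m : (forall l : D, eval z l = eval u l * eval x l) ->
  vanishes_to m x -> vanishes_to m z.
Proof.
move=> zux xm k km; apply: contrapT => zk.
have [L [d [p [zp pL pmin dL]]]] :=
  @leading_weights n (fun k => ycoord z k <> 0) m (ex_intro2 _ _ k zk km).
have [s s0 sD] := Ddomain_box.
have curveD t : 0 <= t <= 1 -> Ddomain mu (curve s d t).
  move=> /andP[t0 t1]; apply: sD => i; rewrite mxE normc_real.
    by rewrite ler_piMr ?(ltW s0)// exprn_ile1.
  by rewrite mulr_ge0 ?exprn_ge0// ltW.
(* With [W = 0] the estimate says that [u] is bounded on the curve, which is all that is required of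
   it. *)
have u0 q : (wdegree d q < 0)%N -> ycoord u q = 0 by [].
have [a a0 ha] := eval_curve_le curveD u0.
(* A weight below [L * m.+1] forces degree at most [m], where [x] vanishes; [pL] places the leading
   weight of [z] strictly below this threshold. *)
have x0 q : (wdegree d q < L * m.+1)%N -> ycoord x q = 0.
  move=> qL; apply: xm; rewrite -ltnS.
  have L0 : (0 < L)%N by move: pL; case: (L).
  by rewrite -(ltn_pmul2l L0); apply: leq_ltn_trans qL.
have [b b0 hb] := eval_curve_le curveD x0.
apply: zp; apply: (@leading_coef_eq0 s d s0 curveD z p (a * b)) => // t t01.
have /andP[t0 t1] := t01.
rewrite zux normcM; apply: le_trans (ler_pM _ _ (ha t t01) (hb t t01)) _;
  rewrite ?normc_ge0//.
rewrite expr0 mulr1 mulrA ler_wpM2l ?mulr_ge0//.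
by rewrite -(subnKC pL) exprD ler_piMr ?exprn_ge0// exprn_ile1.
Qed.

(** The difference evaluates to the product of 0 and 0, and the vector 0 vanishes to every order. *)
Lemma eval_inj x z : eval x = eval z -> x = z.
Proof.
move=> xz; apply/subr0_eq/ycoord_inj/funext => k.
rewrite ycoord0; apply: (@vanishes_to_product 0 (x - z) 0 (mdegree k)) => // [l|p _].
  by rewrite evalB xz subrr !eval0 mul0r.
exact: ycoord0.
Qed.

End vanishing.

(** * The unitary onto H^2; multipliers and the commutant *)

Section multipliers.
Variables (R : realType) (n : nat) (mu : weights R n).
Local Notation C := R[i].
Local Notation multiindex := (multiindex n).
Local Notation dotF := (@l2_dot R (word n)).
Local Notation dotS := (Fs2_dot mu).
Local Notation point := 'rV[R[i]^o]_n.
Local Notation D := (set_type (Ddomain mu)).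
Implicit Types (k p q : multiindex) (x z u v : Fs2 mu).
Hypothesis D_nbhs : nbhs (0 : point) (Ddomain mu).
Let dotSP := Fs2_inner_product mu.
Let omega0 := omega_gt0 mu.
Let dot_yS := Fs2_dot_y mu.
Let totalS := @Fs2_total R n mu.

Lemma eval_H2 x : eval x \in H2_pred (mu := mu).
Proof. by apply: mem_set; exists (ycoord x); exact: power_series_eval. Qed.

Definition Fs2_to_H2 x : H2 mu := HardyFun (eval_H2 x).

Lemma coefsP (phi : H2 mu) : power_series phi (coefs phi).
Proof. have /set_mem[c hc] := H2_funP phi; exact: (@xgetI _ 0 (power_series phi) c hc). Qed.

Lemma Fs2_of_H2_subproof (phi : H2 mu) : exists x, eval x = phi.
Proof. by have [x xphi _] := power_seriesP (coefsP phi); exists x. Qed.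

Definition H2_to_Fs2 (phi : H2 mu) : Fs2 mu := sval (cid (Fs2_of_H2_subproof phi)).

Lemma eval_H2_to_Fs2 phi : eval (H2_to_Fs2 phi) = phi.
Proof. exact: (svalP (cid (Fs2_of_H2_subproof phi))). Qed.

Lemma H2_to_Fs2K : cancel H2_to_Fs2 Fs2_to_H2.
Proof. by move=> phi; apply: val_inj; exact: eval_H2_to_Fs2. Qed.

Lemma Fs2_to_H2K : cancel Fs2_to_H2 H2_to_Fs2.
Proof. by move=> x; apply: (eval_inj D_nbhs); rewrite eval_H2_to_Fs2. Qed.

(** [coefs] chooses some expansion; injectivity of evaluation leaves only one. *)
Lemma coefs_Fs2_to_H2 x : coefs (Fs2_to_H2 x) = ycoord x.
Proof.
have [z zx zc] := power_seriesP (coefsP (Fs2_to_H2 x)).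
by rewrite -zc; congr ycoord; apply: (eval_inj D_nbhs).
Qed.

Lemma Fs2_to_H2_linear : linear Fs2_to_H2.
Proof. by move=> c x z; apply/val_inj/funext => l; exact: evalZD. Qed.

Lemma H2_dot_Fs2_to_H2 x z : H2_dot mu (Fs2_to_H2 x) (Fs2_to_H2 z) = dotS x z.
Proof.
apply: has_csum_unique; rewrite !coefs_Fs2_to_H2.
have := has_csum_dot dotSP omega0 dot_yS totalS (x := x) (z := z).
by congr has_csum; apply/funext => k; rewrite (fmorphV (real_complex R)).
Qed.

Lemma Fs2_to_H2_unitary : unitary dotS (H2_dot mu) Fs2_to_H2 H2_to_Fs2.
Proof.
split; [exact: Fs2_to_H2_linear| |exact: Fs2_to_H2K|exact: H2_to_Fs2K].
by move=> v w; rewrite -{1}[w]H2_to_Fs2K H2_dot_Fs2_to_H2.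
Qed.

Lemma Fs2_to_H2_y k : Fs2_to_H2 (Fs2_y mu k) = H2_monomial mu k.
Proof. by apply/val_inj/funext => l; exact: eval_y. Qed.

(** A unitary preserves the inner products with the [y^(k)], and these are the coordinates up to the
    factors [omega k]. *)
Lemma Fs2_to_H2_unique V Vadj : unitary dotS (H2_dot mu) V Vadj ->
  (forall k, V (Fs2_y mu k) = H2_monomial mu k) -> V = Fs2_to_H2.
Proof.
move=> [_ VV VK _] Vy; apply/funext => x; apply: (can_inj H2_to_Fs2K).
rewrite Fs2_to_H2K; apply/ycoord_inj/funext => k.
rewrite /ycoord /hcoord; congr (_ * _).
rewrite -(H2_dot_Fs2_to_H2 _ (Fs2_y mu k)) H2_to_Fs2K Fs2_to_H2_y -Vy VV.
by rewrite VK.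
Qed.

(** The symbol of [A] is the image of the vacuum: [A y^(k)] is [B^k] applied to that image, and both
    sides are continuous in [x]. *)
Lemma commutant_eval (A : Fs2 mu -> Fs2 mu) x l : B_commutant A ->
  eval (A x) l = eval (A (vacuum mu)) l * eval x l.
Proof.
move=> [bA AB]; have [Al _] := bA; have [M M0 AM] := bounded_opP bA.
apply: (functional_ext dotSP omega0 dot_yS totalS (L := fun x => eval (A x) l)
  (L' := fun x => eval (A (vacuum mu)) l * eval x l) (M := hnorm dotF (kernel l) * M)
  (M' := normc (eval (A (vacuum mu)) l) * hnorm dotF (kernel l))).
- by move=> c u v; rewrite Al evalZD.
- by move=> c u v; rewrite evalZD mulrDr mulrCA.
- move=> v; apply: le_trans (eval_le _ _) _.
  by rewrite -mulrA ler_wpM2l ?hnorm_ge0.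
- by move=> v; rewrite normcM -mulrA ler_wpM2l ?normc_ge0// eval_le.
by move=> k; rewrite (commute_y _ AB) eval_Bpow eval_y mulrC.
Qed.

Lemma commutant_multiplier A : B_commutant A -> exists (phi : D -> C) (phiM : multiplier phi),
  Fs2_to_H2 \o A \o H2_to_Fs2 = mult_op phiM.
Proof.
move=> Acom; pose phi := eval (A (vacuum mu)).
have phiE (f : H2 mu) : phi \* f = eval (A (H2_to_Fs2 f)).
  by apply/funext => l; rewrite (commutant_eval _ _ Acom) eval_H2_to_Fs2.
have phiM : multiplier phi by move=> f; rewrite phiE eval_H2.
exists phi, phiM; apply/funext => f; apply: val_inj.
by rewrite /= phiE.
Qed.

Lemma multiplier_commutant (phi : D -> C) (phiM : multiplier phi) :
  B_commutant (H2_to_Fs2 \o mult_op phiM \o Fs2_to_H2).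
Proof.
set T := _ \o _.
have TE x l : eval (T x) l = phi l * eval x l by rewrite /T /= eval_H2_to_Fs2.
have Tl : linear T.
  move=> c x z; apply: (eval_inj D_nbhs); apply/funext => l.
  by rewrite evalZD !TE evalZD mulrDr mulrCA.
(* The multiplier is itself the evaluation of a vector, hence bounded on the curves used to compare
   orders of vanishing. *)
have phiE l : phi l = eval (T (vacuum mu)) l.
  by rewrite TE vacuumE eval_y monomial0 mulr1.
split; last first.
  move=> i x; apply: (eval_inj D_nbhs); apply/funext => l.
  by rewrite eval_B !TE eval_B mulrCA.
apply: triangular_bounded; split => // m x.
by apply: (vanishes_to_product D_nbhs (u := T (vacuum mu))) => l; rewrite TE phiE.
Qed.

End multipliers.

(** * Operator algebras containing the Cesaro means *)

Lemma sum_interval (a b J : nat) : (\sum_(j < J) (a <= j < b) = minn b J - a)%N.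
Proof. by elim: J => [|J IH]; rewrite ?big_ord0 ?big_ord_recr /= ?IH; lia. Qed.

Section operator_algebras.
Variables (R : realType) (n : nat) (mu : weights R n).
Local Notation C := R[i].
Local Notation multiindex := (multiindex n).
Local Notation dotS := (Fs2_dot mu).
Implicit Types (k p q : multiindex) (x z u v : Fs2 mu) (A T : Fs2 mu -> Fs2 mu).
Implicit Types (S : set (Fs2 mu -> Fs2 mu)).

Lemma op_algebra_bounded : op_algebra dotS (bounded_op dotS).
Proof.
by split=> // [a A B|A B]; [exact: (bounded_op_comb (Fs2_inner_product mu))|exact: bounded_op_comp].
Qed.

Lemma op_algebra_commutant : op_algebra dotS (@B_commutant R n mu).
Proof.
have Bl i : linear (B_op mu i) by apply: shifts_by_linear; exact: shifts_by_B.
split=> [A []//|a A T [bA AB] [bT TB]|A T [bA AB] [bT TB]]; split.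
- exact: (bounded_op_comb (Fs2_inner_product mu)).
- by move=> i x; rewrite AB TB Bl.
- exact: bounded_op_comp.
- by move=> i x; rewrite /= TB AB.
Qed.

Lemma op_algebra_sum S (I : Type) (r : seq I) (F : I -> Fs2 mu -> Fs2 mu) (c : I -> C) :
  op_algebra dotS S -> S id -> (forall i, S (F i)) ->
  S (fun x => \sum_(i <- r) c i *: F i x).
Proof.
move=> [_ Scomb _] Sid SF; elim: r => [|i r IH].
  (* The zero operator arises as [-1] times the identity plus the identity. *)
  have := Scomb (-1) _ _ Sid Sid; congr S; apply/funext => x.
  by rewrite big_nil scaleN1r addNr.
have := Scomb (c i) _ _ (SF i) IH; congr S; apply/funext => x.
by rewrite big_cons.
Qed.

Lemma op_algebra_Bpow S k : op_algebra dotS S -> S id -> (forall i, S (B_op mu i)) ->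
  S (Bpow mu k).
Proof.
move=> [_ _ Scomp] Sid SB; rewrite /Bpow.
elim/big_rec: _ => // i T _ ST; apply: (Scomp _ _ _ ST).
elim: (k i) => // m IH; exact: (Scomp _ _ (SB i) IH).
Qed.

Lemma cesaro_meanE c N x : cesaro_mean mu c N x =
  \sum_(k <- degree_le n N) ((1 - (mdegree k)%:R / N.+1%:R) * c k) *: Bpow mu k x.
Proof. by rewrite /cesaro_mean fsbig_finite//; exact: finite_mdegree_le. Qed.

Lemma op_algebra_cesaro S c N : op_algebra dotS S -> S id -> (forall i, S (B_op mu i)) ->
  S (cesaro_mean mu c N).
Proof.
move=> Salg Sid SB; have -> : cesaro_mean mu c N = _ := funext (cesaro_meanE c N).
by apply: op_algebra_sum => // k; exact: op_algebra_Bpow.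
Qed.

Lemma bounded_B i : bounded_op dotS (B_op mu i).
Proof. exact: (shifts_by_bounded (@shifts_by_B _ _ mu i)). Qed.

Lemma bounded_cesaro c N : bounded_op dotS (cesaro_mean mu c N).
Proof.
apply: op_algebra_cesaro; [exact: op_algebra_bounded|exact: bounded_op_id|exact: bounded_B].
Qed.

Lemma commutant_id : @B_commutant R n mu id.
Proof. by split=> //; exact: bounded_op_id. Qed.

Lemma commutant_B i : B_commutant (B_op mu i).
Proof.
split; first exact: bounded_B.
move=> j x; have := shifts_by_comp (@shifts_by_B _ _ mu i) (@shifts_by_B _ _ mu j).
rewrite maddC => /shifts_by_unique.
move=> /(_ _ (shifts_by_comp (@shifts_by_B _ _ mu j) (@shifts_by_B _ _ mu i))).
by move=> /(congr1 (fun f => f x)).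
Qed.

End operator_algebras.

(** * Uniform bound and strong convergence of the Cesaro means *)

Section cesaro_means.
Variables (R : realType) (n : nat) (mu : weights R n).
Local Notation C := R[i].
Local Notation multiindex := (multiindex n).
Local Notation dotS := (Fs2_dot mu).
Local Notation norm := (hnorm dotS).
Local Notation coordP := (hproj dotS (Fs2_y mu) (omega mu)).
Local Notation degree_le := (degree_le n).
Implicit Types (k p q : multiindex) (x z u v : Fs2 mu).
Let dotSP := Fs2_inner_product mu.
Let omega0 := omega_gt0 mu.
Let dot_yS := Fs2_dot_y mu.
Let totalS := @Fs2_total R n mu.

(** The multi-indices with degree from [j - N] to [j], written as an addition so that [j < N] causes
    no truncation. *)
Definition window N j : {fset multiindex} :=
  [fset k in degree_le j | (j <= mdegree k + N)%N]%fset.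

Lemma in_window N j k : (k \in window N j) = (mdegree k <= j < (mdegree k + N).+1)%N.
Proof. by rewrite !inE /= in_degree_le ltnS. Qed.

(** Each multi-index lies in at most [N.+1] of the windows. *)
Lemma sum_window_sqr N J x :
  \sum_(j < J) norm (coordP (window N j) x) ^+ 2 <= N.+1%:R * norm x ^+ 2.
Proof.
pose g k := (omega mu k)^-1 * normc (ycoord x k) ^+ 2.
have g0 k : 0 <= g k by rewrite mulr_ge0 ?sqr_ge0// invr_ge0 omega_ge0.
have E (j : 'I_J) : norm (coordP (window N j) x) ^+ 2 =
    \sum_(k <- degree_le J) (mdegree k <= j < (mdegree k + N).+1)%N%:R * g k.
  rewrite (hnorm_hproj dotSP omega0 dot_yS).
  rewrite (_ : window N j = [fset k in degree_le J | (mdegree k <= j < (mdegree k + N).+1)%N]%fset).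
    rewrite -big_fset_condE big_mkcond; apply: eq_bigr => k _.
    by case: ifP => _; rewrite ?mul1r ?mul0r.
  apply/fsetP => k; rewrite in_window !inE /= in_degree_le.
  by have := ltn_ord j; lia.
under eq_bigr do rewrite E.
rewrite exchange_big /=.
have h k : \sum_(j < J) (mdegree k <= j < (mdegree k + N).+1)%N%:R * g k <= N.+1%:R * g k.
  by rewrite -mulr_suml -natr_sum sum_interval ler_wpM2r// ler_nat; lia.
apply: le_trans (ler_sum _ (fun k _ => h k)) _.
rewrite -mulr_sumr -(hnorm_hproj dotSP omega0 dot_yS) ler_wpM2l//.
by rewrite ler_sqr ?nnegrE ?hnorm_ge0// (hnorm_hproj_le dotSP omega0 dot_yS).
Qed.

Section one_operator.
Variable A : Fs2 mu -> Fs2 mu.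
Hypothesis Acom : B_commutant A.
Let c := ycoord (A (vacuum mu)).
Local Notation sigma N := (cesaro_mean mu c N).

Lemma ycoord_Ay q p : ycoord (A (Fs2_y mu q)) p = if mle q p then c (msub p q) else 0.
Proof. by have [_ AB] := Acom; rewrite (commute_y _ AB) shifts_by_Bpow. Qed.

Definition fejer N (d : nat) : R := if (d <= N)%N then 1 - d%:R / N.+1%:R else 0.

Lemma ycoord_sigma_y N q p : ycoord (sigma N (Fs2_y mu q)) p =
  if mle q p then (fejer N (mdegree (msub p q)))%:C * c (msub p q) else 0.
Proof.
rewrite cesaro_meanE ycoord_sum.
under eq_bigr do rewrite ycoordZ (shifts_by_y _ (@shifts_by_Bpow _ _ mu _)) ycoord_y.
case: ifP => qp; last first.
  rewrite big1// => k _; rewrite (_ : (_ == p) = false) ?mulr0//.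
  by apply/eqP => kp; rewrite -kp maddC mle_madd in qp.
have kE k : (madd q k == p) = (k == msub p q).
  by apply/eqP/eqP => [<-|->]; rewrite maddC ?maddK ?msubK.
rewrite /fejer; case: ifP => pN.
  rewrite (big_fsetD1 (msub p q)) ?in_degree_le//= kE eqxx mulr1 big_seq big1 ?addr0.
    by rewrite rmorphB/= rmorph1 (fmorph_div (real_complex R)) !(rmorph_nat (real_complex R)).
  by move=> k; rewrite !inE kE => /andP[/negbTE -> _]; rewrite mulr0.
rewrite mul0r big_seq big1// => k; rewrite in_degree_le kE => kN.
by case: eqP => [kpq|_]; rewrite ?mulr0//; rewrite -kpq kN in pN.
Qed.

(* The Toeplitz matrix [fejer N `|d - e|] is the average of the rank one matrices
   [1_I(d) 1_I(e)] over the N + 1 windows [I] of length N + 1. *)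
Lemma window_average_y N J q : (mdegree q + N < J)%N ->
  N.+1%:R *: sigma N (Fs2_y mu q) =
    \sum_(j < J) coordP (window N j) (A (coordP (window N j) (Fs2_y mu q))).
Proof.
move=> qJ; have [[Al _] _] := Acom.
apply/ycoord_inj/funext => p; rewrite ycoordZ ycoord_sigma_y ycoord_sum.
have Qy j : coordP (window N j) (Fs2_y mu q) =
    (mdegree q <= j < (mdegree q + N).+1)%N%:R *: Fs2_y mu q.
  apply/ycoord_inj/funext => k; rewrite /ycoord (hcoord_hproj dotSP omega0 dot_yS) in_window.
  rewrite -!/(ycoord _ k) ycoordZ ycoord_y; case: (eqVneq q k) => [<-|_].
    by rewrite mulr1; case: ifP.
  by rewrite mulr0; case: ifP.
have E j : ycoord (coordP (window N j) (A (coordP (window N j) (Fs2_y mu q)))) p =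
    (if mle q p then c (msub p q) else 0) *
    ((mdegree p <= j < (mdegree p + N).+1) && (mdegree q <= j < (mdegree q + N).+1))%N%:R.
  rewrite Qy linear_funZ// /ycoord (hcoord_hproj dotSP omega0 dot_yS) in_window -/(ycoord _ p).
  rewrite ycoordZ ycoord_Ay mulrC.
  by case: (_ <= j < _)%N; case: (_ <= j < _)%N; rewrite ?mulr0 ?mulr1.
under eq_bigr do rewrite E.
rewrite -mulr_sumr; case: ifP => qp; last by rewrite mulr0 mul0r.
rewrite mulrA mulrC; congr (_ * _).
have pq : mdegree p = (mdegree (msub p q) + mdegree q)%N by rewrite -mdegreeD msubK.
rewrite -natr_sum.
(* As [mdegree q <= mdegree p], the common windows run from [mdegree p] to [mdegree q + N]. With [d]
   the difference of the degrees there are [N + 1 - d] of them, or none, and [J] is large enough to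
   count them all. *)
rewrite (eq_bigr (fun j : 'I_J => (mdegree p <= j < (mdegree q + N).+1)%N : nat)); last first.
  by move=> j _; congr nat_of_bool; lia.
rewrite sum_interval /fejer; case: ifP => dN.
  rewrite -(rmorph_nat (real_complex R)) -[in RHS](rmorph_nat (real_complex R)) -real_complexM.
  congr (_%:C); rewrite mulrBr mulr1 mulrC divfK ?pnatr_eq0//.
  by rewrite -natrB; [congr (_%:R); lia|lia].
by rewrite mulr0 (_ : (_ - _)%N = 0%N)//; lia.
Qed.

Lemma window_average N J m x : (m + N < J)%N ->
  N.+1%:R *: sigma N (coordP (degree_le m) x) =
    \sum_(j < J) coordP (window N j) (A (coordP (window N j) (coordP (degree_le m) x))).
Proof.
move=> mJ; have [[Al _] _] := Acom; have [sl _] := bounded_cesaro mu c N.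
have Ql F : linear (coordP F) by move=> a u v; exact: hprojZD.
rewrite [coordP (degree_le m) x]/hproj (@linear_fun_sum _ _ (sigma N))// scaler_sumr.
have E j : coordP (window N j) (A (coordP (window N j)
      (\sum_(k <- degree_le m) hcoord dotS (Fs2_y mu) (omega mu) x k *: Fs2_y mu k))) =
    \sum_(k <- degree_le m) hcoord dotS (Fs2_y mu) (omega mu) x k *:
      coordP (window N j) (A (coordP (window N j) (Fs2_y mu k))).
  rewrite !(linear_fun_sum _ _ _ (Ql (window N j))) (linear_fun_sum _ _ _ Al).
  rewrite (linear_fun_sum _ _ _ (Ql (window N j))); apply: eq_bigr => k _.
  by rewrite !(linear_funZ _ _ (Ql _)) !(linear_funZ _ _ Al) !(linear_funZ _ _ (Ql _)).
rewrite [RHS](eq_bigr _ (fun (j : 'I_J) _ => E j)) exchange_big/=.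
rewrite big_seq [RHS]big_seq; apply: eq_bigr => k; rewrite in_degree_le => km.
rewrite -scaler_sumr (linear_funZ _ _ sl) scalerA mulrC -scalerA (@window_average_y N J)//.
by apply: leq_ltn_trans mJ; rewrite leq_add2r.
Qed.

(** Pair the window average of [u] with its value [z]. The window projections are self-adjoint, so
    each summand is at most [M * norm (Q u) * norm (Q z)], hence half the sum of two squares; the
    overlap bound [N.+1] then cancels the factor on the left. *)
Lemma cesaro_le_finite M N m x : 0 <= M -> (forall v, norm (A v) <= M * norm v) ->
  norm (sigma N (coordP (degree_le m) x)) <= M * norm (coordP (degree_le m) x).
Proof.
move=> M0 AM; set u := coordP (degree_le m) x; set z := sigma N u.
have avg := @window_average N (m + N).+1 m x (ltnSn _); rewrite -/u -/z in avg.
clearbody z; clearbody u.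
have N0 : 0 < N.+1%:R :> R by rewrite ltr0n.
have sq : N.+1%:R * norm z ^+ 2 <=
    (M ^+ 2 * (\sum_(j < (m + N).+1) norm (coordP (window N j) u) ^+ 2) +
     \sum_(j < (m + N).+1) norm (coordP (window N j) z) ^+ 2) / 2.
  rewrite mulr_sumr -big_split mulr_suml /=.
  have -> : N.+1%:R * norm z ^+ 2 = normc (dotS (N.+1%:R *: z) z).
    rewrite (dotZl dotSP) normcM (dotxx dotSP) normc_real ?sqr_ge0//.
    by rewrite -[in RHS](rmorph_nat (real_complex R)) normc_real.
  rewrite avg (dot_suml dotSP); apply: le_trans (normc_sum _ _) _.
  apply: ler_sum => j _; rewrite (@dot_hprojC _ _ _ _ _ _ dotSP omega0).
  apply: le_trans (CauchySchwarz dotSP _ _) _.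
  have := AM (coordP (window N j) u); have := hnorm_ge0 dotS (coordP (window N j) z).
  move: (norm (A _)) (norm (coordP _ z)) (norm (coordP _ u)) => a b d b0 ad.
  have : a * b <= M * d * b by rewrite ler_wpM2r.
  by have := sqr_ge0 (M * d - b); nra.
(* The right side now contains half of the left side, which is absorbed. *)
have h3 := lerD (ler_wpM2l (sqr_ge0 M) (sum_window_sqr N (m + N).+1 u))
  (sum_window_sqr N (m + N).+1 z).
rewrite ler_pdivlMr// in sq; have {sq h3} := le_trans sq h3 => sq.
have h : N.+1%:R * norm z ^+ 2 <= N.+1%:R * (M * norm u) ^+ 2.
  by rewrite exprMn; move: sq; move: (norm z) (norm u) => a b; lra.
by rewrite ler_pM2l// ler_sqr ?nnegrE ?mulr_ge0 ?hnorm_ge0// in h.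
Qed.

(** For fixed [N] the mean has some bound [K]; it may depend on [N], since it only serves to make
    the truncation error small. *)
Lemma cesaro_le M N x : 0 <= M -> (forall v, norm (A v) <= M * norm v) ->
  norm (sigma N x) <= M * norm x.
Proof.
move=> M0 AM; apply/ler_addgt0Pr => e e0.
have [K K0 sK] := bounded_opP (bounded_cesaro mu c N); have [sl _] := bounded_cesaro mu c N.
have K1 : 0 < K + 1 by rewrite ltr_wpDl.
have [m0 /(_ _ (leqnn _)) h] := Q_cvg x (divr_gt0 e0 K1).
rewrite -[x in norm (sigma N x)](subrK (coordP (degree_le m0) x)) (linear_funD _ _ sl).
apply: le_trans (hnormD dotSP _ _) _; rewrite addrC lerD//.
  apply: le_trans (cesaro_le_finite _ _ _ M0 AM) _; rewrite ler_wpM2l//.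
  exact: (hnorm_hproj_le dotSP omega0 dot_yS).
apply: le_trans (sK _) _; apply: (@le_trans _ _ (K * (e / (K + 1)))).
  by rewrite ler_wpM2l// ltW.
by rewrite mulrCA ler_piMr ?(ltW e0)// ler_pdivrMr// mul1r lerDl.
Qed.

(** The coordinates of the difference are those of [A y^(q)] times [fejer - 1], which is at most 1
    in modulus and tends to 0; dominated convergence applies. *)
Lemma cesaro_cvg_y q (e : R) : 0 < e -> exists N0, forall N, (N0 <= N)%N ->
  norm (sigma N (Fs2_y mu q) - A (Fs2_y mu q)) < e.
Proof.
have fejerB N d : `|fejer N d - 1| <= 1.
  rewrite /fejer; case: ifP => dN; last by rewrite sub0r normrN normr1.
  rewrite addrAC subrr add0r normrN ger0_norm ?divr_ge0// ler_pdivrMr ?ltr0n// mul1r.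
  by rewrite ler_nat ltnW// ltnS.
have zE N p : ycoord (sigma N (Fs2_y mu q) - A (Fs2_y mu q)) p =
    if mle q p then (fejer N (mdegree (msub p q)) - 1)%:C * c (msub p q) else 0.
  rewrite ycoordB ycoord_sigma_y ycoord_Ay; case: ifP => _; last by rewrite subrr.
  by rewrite rmorphB mulrBl mul1r.
have nE N p : mle q p -> normc (ycoord (sigma N (Fs2_y mu q) - A (Fs2_y mu q)) p) =
    `|fejer N (mdegree (msub p q)) - 1| * normc (c (msub p q)).
  by move=> qp; rewrite zE qp normcM /normc/= expr0n/= addr0 sqrtr_sqr.
apply: (hnorm_cvg0 dotSP omega0 dot_yS totalS (u := A (Fs2_y mu q))).
  move=> N p; rewrite -!/(ycoord _ p); case qp: (mle q p).
    by rewrite nE// ycoord_Ay qp ler_piMl ?normc_ge0.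
  by rewrite zE qp normc0 normc_ge0.
move=> p {}e e0; case qp: (mle q p); last first.
  by exists 0%N => N _; rewrite -/(ycoord _ p) zE qp normc0.
pose d := mdegree (msub p q); pose a := normc (c (msub p q)).
(* The summand [d] puts [N] in the nonzero branch of [fejer], the other makes [d * a / N.+1] smaller
   than [e]. *)
exists (d + Num.bound (d%:R * a / e))%N => N hN; rewrite -/(ycoord _ p) nE// -/d -/a.
have dN : (d <= N)%N by apply: leq_trans hN; exact: leq_addr.
rewrite /fejer dN addrAC subrr add0r normrN ger0_norm ?divr_ge0// mulrAC.
rewrite ltr_pdivrMr ?ltr0n// [e * _]mulrC -ltr_pdivrMr//.
have h0 : 0 <= d%:R * a / e by rewrite divr_ge0 ?mulr_ge0 ?normc_ge0// ltW.
apply: lt_le_trans (archi_boundP h0) _; rewrite ler_nat.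
by apply: leqW; apply: leq_trans hN; exact: leq_addl.
Qed.

Lemma cesaro_cvg v (e : R) : 0 < e -> exists N0, forall N, (N0 <= N)%N ->
  norm (sigma N v - A v) < e.
Proof.
have [[Al _] _] := Acom; have [M M0 AM] := bounded_opP (proj1 Acom).
have sl N : linear (sigma N) by have [] := bounded_cesaro mu c N.
have fin F (e' : R) : 0 < e' -> exists N0, forall N, (N0 <= N)%N ->
    norm (sigma N (coordP F v) - A (coordP F v)) < e'.
  rewrite /hproj; elim: (enum_fset F) e' => [|k r IH] e' e'0.
    exists 0%N => N _; rewrite big_nil.
    by rewrite (linear_fun0 (sl N)) (linear_fun0 Al) subrr (hnorm0 dotSP).
  pose a := hcoord dotS (Fs2_y mu) (omega mu) v k.
  have a1 : 0 < normc a + 1 by rewrite ltr_wpDl ?normc_ge0.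
  have [N1 h1] := IH (e' / 2) (divr_gt0 e'0 (@ltr0Sn R 1)).
  have [N2 h2] := cesaro_cvg_y k (divr_gt0 (divr_gt0 e'0 (@ltr0Sn R 1)) a1).
  exists (maxn N1 N2) => N; rewrite geq_max => /andP[/h1 {}h1 /h2 {}h2].
  rewrite big_cons -/a sl Al opprD addrACA -scalerBr.
  apply: le_lt_trans (hnormD dotSP _ _) _; rewrite (hnormZ dotSP) [ltRHS](splitr e').
  rewrite ltrD//.
  apply: (@le_lt_trans _ _
    ((normc a + 1) * norm (sigma N (Fs2_y mu k) - A (Fs2_y mu k)))).
    by rewrite ler_wpM2r ?hnorm_ge0// lerDl.
  by rewrite mulrC -ltr_pdivlMr.
move=> e0; have M1 : 0 < M + 1 by rewrite ltr_wpDl.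
have e3 : 0 < e / 3 by rewrite divr_gt0.
(* The bound [M] holds for [A] and for all means at once, so each of them moves the tail [v - u] by
   at most [e / 3]. *)
have [F /(_ _ (fsubset_refl _)) hF] := hexpansionP dotSP omega0 dot_yS totalS v (divr_gt0 e3 M1).
have [N0 h] := fin F (e / 3) e3; exists N0 => N /h {h}.
move: hF; set u := coordP F v => hF h.
have -> : sigma N v - A v = sigma N (v - u) - A (v - u) + (sigma N u - A u).
  rewrite (linear_funB _ _ (sl N)) (linear_funB _ _ Al).
  by rewrite opprB -addrA [X in _ = _ + X]addrC !subrKA.
have b0 : M * norm (v - u) <= e / 3.
  apply: (@le_trans _ _ ((M + 1) * norm (v - u))).
    by rewrite ler_wpM2r ?hnorm_ge0// lerDl.
  by apply/ltW; rewrite mulrC -ltr_pdivlMr.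
have b1 := le_trans (cesaro_le N (v - u) M0 AM) b0; have b2 := le_trans (AM (v - u)) b0.
apply: le_lt_trans (hnormD dotSP _ _) _.
have := hnormD dotSP (sigma N (v - u)) (- A (v - u)); rewrite (hnormN dotSP).
move: b1 b2 h; move: (norm (sigma N (v - u))) (norm (A (v - u))) (norm (_ - A (v - u)))
  (norm (_ - A u)) => a1 a2 a3 a4; lra.
Qed.

Lemma cesaro_sot : sot_cvg dotS (fun N => sigma N) A.
Proof.
move=> v; apply/cvgrPdist_lt => e /(cesaro_cvg v)[N0 h]; exists N0 => // N /= /h.
by rewrite sub0r normrN ger0_norm// hnorm_ge0.
Qed.

End one_operator.
End cesaro_means.

(** * The w*-topology *)

Section wstar_topology.
Variables (R : realType) (V : lmodType R[i]) (dot : V -> V -> R[i]).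
Hypothesis dotP : inner_product dot.
Implicit Types (u v : V) (T : V -> V).
Local Notation norm := (hnorm dot).

(** With such sequences the trace functionals include the weak ones, [T] to [dot (T u) v]. *)
Definition seq_delta v (j : nat) : V := if j == 0%N then v else 0.

Lemma square_summable_delta v : square_summable dot (seq_delta v).
Proof.
rewrite /square_summable (_ : (fun j : nat => _) =
    (fun j => if j \in [set 0%N] then (norm v ^+ 2)%:E else 0%E)); last first.
  apply/funext => j; rewrite /seq_delta (_ : (j \in [set 0%N]) = (j == 0%N)).
    by case: eqP => //; rewrite (hnorm0 dotP) expr0n.
  by apply/idP/eqP; rewrite inE.
rewrite -esum_mkcond esum_set1 ?ltry// lee_fin sqr_ge0//.
Qed.

Lemma trace_functional_delta u v T :
  trace_functional dot (seq_delta u) (seq_delta v) T = dot (T u) v.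
Proof.
apply: has_csum_unique; have := has_csum_delta 0%N (a := dot (T u) v).
congr has_csum; apply/funext => j; rewrite /seq_delta.
by case: eqP => //; rewrite (dot0r dotP).
Qed.

Section bounded_sequence.
Variables (T_ : nat -> V -> V) (T : V -> V) (M : R).
Hypothesis T_le : forall N v, norm (T_ N v - T v) <= M * norm v.
Hypothesis T_cvg : forall v (e : R), 0 < e -> exists N0, forall N, (N0 <= N)%N ->
  norm (T_ N v - T v) < e.

(** The uniform bound makes the tails of the series small independently of [N]; strong convergence
    handles the finitely many remaining terms. *)
Lemma trace_functional_cvg xi eta (e : R) :
  square_summable dot xi -> square_summable dot eta -> 0 < e ->
  exists N0, forall N, (N0 <= N)%N ->
    normc (trace_functional dot xi eta (T_ N \- T)) < e.
Proof.
move=> xioo etaoo e0.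
pose f N j := dot (T_ N (xi j) - T (xi j)) (eta j).
(* A summable majorant of [|M| * norm (xi j) * norm (eta j)]. *)
pose g j := `|M| * (norm (xi j) ^+ 2 + norm (eta j) ^+ 2).
have g0 j : 0 <= g j by rewrite mulr_ge0// addr_ge0 ?sqr_ge0.
have fg N j : normc (f N j) <= g j.
  apply: le_trans (CauchySchwarz dotP _ _) _.
  have := hnorm_ge0 dot (eta j); have := hnorm_ge0 dot (xi j).
  have : norm (T_ N (xi j) - T (xi j)) <= `|M| * norm (xi j).
    by apply: le_trans (T_le _ _) _; rewrite ler_wpM2r ?hnorm_ge0 ?ler_norm.
  rewrite /g; have := normr_ge0 M.
  move: (norm (_ - _)) (norm (xi j)) (norm (eta j)) `|M| => a b d K K0 aKb b0 d0.
  have h1 : a * d <= K * b * d by rewrite ler_wpM2r.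
  have h2 : 0 <= K * (b ^+ 2 + d ^+ 2 - b * d).
    by rewrite mulr_ge0//; have := sqr_ge0 (b - d); nra.
  by move: h2; rewrite mulrBr subr_ge0 mulrA; exact: le_trans.
have goo : (\esum_(j in setT) (g j)%:E < +oo)%E.
  have : (\esum_(j in setT) ((norm (xi j) ^+ 2)%:E + (norm (eta j) ^+ 2)%:E) < +oo)%E.
    rewrite esumD; [|by move=> j _; rewrite lee_fin sqr_ge0..].
    exact: lte_add_pinfty.
  have E : (\esum_(j in setT) (g j)%:E <=
     (`|M|)%:E * \esum_(j in setT) ((norm (xi j) ^+ 2)%:E + (norm (eta j) ^+ 2)%:E))%E.
    apply: ge_ereal_sup => _ [X [finX _] <-].
    rewrite (eq_fsbigr (fun j => (`|M|)%:E * ((norm (xi j) ^+ 2)%:E + (norm (eta j) ^+ 2)%:E))%E).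
      rewrite -ge0_mule_fsumr; last by move=> j; rewrite -EFinD lee_fin addr_ge0 ?sqr_ge0.
      by apply: lee_wpmul2l; rewrite ?lee_fin//; apply: ereal_sup_ubound; exists X.
    by move=> j _; rewrite -EFinD -EFinM.
  move=> h; apply: (le_lt_trans E); exact: lte_mul_pinfty.
have e3 : 0 < e / 3 by rewrite divr_gt0.
have [F hF] := esum_tail g0 goo e3.
have [N0 hN0] : exists N0, forall N, (N0 <= N)%N -> \sum_(j <- F) normc (f N j) < e / 3.
  elim: (enum_fset F) (e / 3) e3 {hF} => [|j r IH] d d0.
    by exists 0%N => N _; rewrite big_nil.
  have [N1 h1] := IH (d / 2) (divr_gt0 d0 (@ltr0Sn R 1)).
  have a1 : 0 < norm (eta j) + 1 by rewrite ltr_wpDl ?hnorm_ge0.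
  have [N2 h2] := T_cvg (xi j) (divr_gt0 (divr_gt0 d0 (@ltr0Sn R 1)) a1).
  exists (maxn N1 N2) => N; rewrite geq_max => /andP[/h1 {}h1 /h2 {}h2].
  rewrite big_cons [ltRHS](splitr d) ltrD//.
  apply: le_lt_trans (CauchySchwarz dotP _ _) _; rewrite mulrC.
  apply: (@le_lt_trans _ _ ((norm (eta j) + 1) * norm (T_ N (xi j) - T (xi j)))).
    by rewrite ler_wpM2r ?hnorm_ge0// lerDl.
  by rewrite mulrC -ltr_pdivlMr.
exists N0 => N /hN0 {}hN0.
(* [trace_functional] is a [csum], whose value can be used once convergence is known. *)
have [s fs] := has_csum_dominated (fg N) goo.
have -> : trace_functional dot xi eta (T_ N \- T) = s by exact: has_csum_unique.
apply: (@le_lt_trans _ _ (e / 3 + e / 3)); last by lra.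
apply: has_csum_le fs => J; apply: le_trans (normc_sum _ _) _.
rewrite (bigID (mem F))/=; apply: lerD.
  apply: le_trans (ltW hN0).
  have -> : \sum_(j <- J | j \in F) normc (f N j) = \sum_(j <- F | j \in J) normc (f N j).
    rewrite big_fset_condE [RHS]big_fset_condE; apply: eq_fbigl => j.
    by rewrite !inE/= andbC.
  rewrite big_mkcond; apply: ler_sum => j _.
  by case: ifP => // _; exact: normc_ge0.
by apply: le_trans (ltW (hF J)); apply: ler_sum => j _; exact: fg.
Qed.

Lemma wstar_adherent_sot (S : set (V -> V)) : (forall N, S (T_ N)) -> wstar_adherent dot S T.
Proof.
move=> ST m xi eta e xioo etaoo e0.
pose N0 l := sval (cid (trace_functional_cvg (xioo l) (etaoo l) e0)).
exists (T_ (\max_l N0 l)) => // l.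
apply: (svalP (cid (trace_functional_cvg (xioo l) (etaoo l) e0))).
exact: (leq_bigmax l).
Qed.

End bounded_sequence.
End wstar_topology.

(** * The Hardy algebra as the commutant; Fourier representations *)

Section Hardy_algebra.
Variables (R : realType) (n : nat) (mu : weights R n).
Local Notation C := R[i].
Local Notation multiindex := (multiindex n).
Local Notation dotS := (Fs2_dot mu).
Implicit Types (k p q : multiindex) (x z u v : Fs2 mu) (A T : Fs2 mu -> Fs2 mu).
Let dotSP := Fs2_inner_product mu.
Let omega0 := omega_gt0 mu.
Let dot_yS := Fs2_dot_y mu.
Let totalS := @Fs2_total R n mu.

(** The adjoint of [B_i] on the vectors [y^(p)], enough for testing commutation coordinate by
    coordinate. *)
Lemma B_adjoint_y i p : exists w, forall z, dotS (B_op mu i z) (Fs2_y mu p) = dotS z w.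
Proof.
case ip: (mle (mdelta i) p).
  exists ((omega mu (msub p (mdelta i)) * (omega mu p)^-1)%:C *: Fs2_y mu (msub p (mdelta i))) => z.
  rewrite (dotZr dotSP) conjc_real !(dot_hcoord dotS (Fs2_y mu) omega0).
  rewrite -!/(ycoord _ _) (@shifts_by_B _ _ mu i) ip [RHS]mulrCA; congr (_ * _).
  rewrite -real_complexM; congr (_%:C).
  by rewrite mulrAC mulfV ?mul1r// gt_eqF// omega_gt0.
exists 0 => z; rewrite (dot0r dotSP) (dot_hcoord dotS (Fs2_y mu) omega0) -/(ycoord _ _).
by rewrite (@shifts_by_B _ _ mu i) ip mul0r.
Qed.

(** With [w] the adjoint image of [y^(p)], commutation says that the weak functionals given by the
    pairs [(B_i x, y^(p))] and [(x, w)] agree on [T]. They agree on the commutant, and approximating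
    [T] in both at once transfers this. *)
Lemma wstar_closed_commutant : wstar_closed dotS (@B_commutant R n mu).
Proof.
move=> T bT adh; split=> // i x; apply/ycoord_inj/funext => p.
rewrite /ycoord /hcoord; congr (_ * _).
have [w Bw] := B_adjoint_y i p; rewrite Bw.
apply/subr0_eq/eq0_normc/eqP; rewrite eq_le normc_ge0 andbT.
apply/ler_addgt0Pr => e e0; rewrite add0r.
pose pick (a b : Fs2 mu) (l : 'I_2) := seq_delta (if l == ord0 then a else b).
have ss a b l : square_summable dotS (pick a b l) by exact: square_summable_delta.
have [A [_ AB] hA] := adh 2%N (pick (B_op mu i x) x) (pick (Fs2_y mu p) w) (e / 2)
  (ss _ _) (ss _ _) (divr_gt0 e0 (@ltr0Sn R 1)).
have := hA ord0; have := hA (lift ord0 ord0); rewrite /pick /= !(trace_functional_delta dotSP).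
rewrite !(dotBl dotSP) AB Bw => h1 h2.
have -> : dotS (T (B_op mu i x)) (Fs2_y mu p) - dotS (T x) w =
    (dotS (A x) w - dotS (T x) w) - (dotS (A x) w - dotS (T (B_op mu i x)) (Fs2_y mu p)).
  by rewrite opprB addrC -addrA [in RHS]addrA [RHS]addrC; ring.
apply: le_trans (le_normcD _ _) _; rewrite normcN.
by move: h1 h2; move: (normc _) (normc _) => a b; lra.
Qed.

Lemma Fs_inftyE : Fs_infty mu = @B_commutant R n mu.
Proof.
apply/seteqP; split=> A.
  apply; [exact: op_algebra_commutant|exact: wstar_closed_commutant|].
  by move=> _ [[i _ <-]|->]; [exact: commutant_B|exact: commutant_id].
move=> Acom S Salg Sclosed GS; have bA := proj1 Acom; apply: Sclosed => //.
have [M M0 AM] := bounded_opP bA.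
pose c := ycoord (A (vacuum mu)).
apply: (@wstar_adherent_sot _ _ _ dotSP (cesaro_mean mu c) A (M + M)).
- move=> N v; apply: le_trans (hnormD dotSP _ _) _; rewrite (hnormN dotSP) mulrDl.
  by rewrite lerD// (cesaro_le Acom).
- exact: cesaro_cvg.
- move=> N; apply: op_algebra_cesaro => //; first by apply: GS; right.
  by move=> i; apply: GS; left; exists i.
Qed.

(** Coordinates are bounded functionals, so they read the coefficients off any convergent series. *)
Lemma fourier_repE A d : fourier_rep mu A d <-> d = ycoord (A (vacuum mu)).
Proof.
split=> [h|->]; last exact: (hexpansion dotSP omega0 dot_yS totalS).
apply/funext => p; have := has_hsum_functional (L := fun x => ycoord x p)
  (fun a u v => ycoordZD a u v p) (fun u => hnorm_ycoord_le u p) h.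
move=> /has_csum_inj hp; apply/esym/hp; have := has_csum_delta p (a := d p).
congr has_csum; apply/funext => k; rewrite ycoordZ ycoord_y.
by case: eqP => [->|_]; rewrite ?mulr1 ?mulr0.
Qed.

(** As [B^k y^(p) = B^p y^(k)], the series is the bounded operator [B^p] applied to the expansion of
    the image of the vacuum. *)
Lemma has_hsum_fourier A p : B_commutant A ->
  has_hsum dotS (fun k => ycoord (A (vacuum mu)) k *: Bpow mu k (Fs2_y mu p)) (A (Fs2_y mu p)).
Proof.
move=> Acom; have [_ AB] := Acom; rewrite (commute_y _ AB).
have bB := shifts_by_bounded (@shifts_by_Bpow _ _ mu p); have [Bl _] := bB.
have -> : (fun k => ycoord (A (vacuum mu)) k *: Bpow mu k (Fs2_y mu p)) =
    (fun k => Bpow mu p (ycoord (A (vacuum mu)) k *: Fs2_y mu k)).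
  apply/funext => k; rewrite (linear_funZ _ _ Bl).
  rewrite (shifts_by_y k (@shifts_by_Bpow _ _ mu p)).
  by rewrite (shifts_by_y p (@shifts_by_Bpow _ _ mu k)) maddC.
exact: (has_hsum_bounded_op bB (hexpansion dotSP omega0 dot_yS totalS (A (vacuum mu)))).
Qed.

End Hardy_algebra.

Theorem theorem6p3 (R : realType) (n : nat) (n_gt0 : (0 < n)%N)
    (mu : weights R n)
    (D_nbhs : nbhs (0 : 'rV[R[i]^o]_n) (Ddomain mu)) :
  (exists (U : Fs2 mu -> H2 mu) (Uadj : H2 mu -> Fs2 mu),
     [/\ unitary (Fs2_dot mu) (H2_dot mu) U Uadj,
         forall k, U (Fs2_y mu k) = H2_monomial mu k,
         forall V Vadj, unitary (Fs2_dot mu) (H2_dot mu) V Vadj ->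
           (forall k, V (Fs2_y mu k) = H2_monomial mu k) -> V = U &
         [set U \o A \o Uadj | A in Fs_infty mu] =
         [set T | exists (phi : set_type (Ddomain mu) -> R[i])
                    (phiM : multiplier phi), T = mult_op phiM]]) /\
  (forall A : Fs2 mu -> Fs2 mu, Fs_infty mu A ->
     exists c : multiindex n -> R[i],
       [/\ fourier_rep mu A c,
           forall d, fourier_rep mu A d -> d = c,
           forall p, has_hsum (Fs2_dot mu)
             (fun k => c k *: Bpow mu k (Fs2_y mu p)) (A (Fs2_y mu p)) &
           sot_cvg (Fs2_dot mu) (cesaro_mean mu c) A]).
Proof.
rewrite Fs_inftyE; split=> [|A Acom]; last first.
  exists (ycoord (A (vacuum mu))); split.
  - exact/fourier_repE.
  - by move=> d /fourier_repE.
  - by move=> p; exact: has_hsum_fourier.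
  - exact: cesaro_sot.
exists (@Fs2_to_H2 R n mu), (@H2_to_Fs2 R n mu); split.
- exact: Fs2_to_H2_unitary.
- exact: Fs2_to_H2_y.
- by move=> V Vadj; exact: Fs2_to_H2_unique.
apply/seteqP; split=> [_ [A /commutant_multiplier[phi [phiM AphiM]] <-]|_ [phi [phiM ->]]].
  by exists phi, phiM.
exists (@H2_to_Fs2 R n mu \o mult_op phiM \o @Fs2_to_H2 R n mu).
  exact: multiplier_commutant.
by apply/funext => f /=; rewrite !H2_to_Fs2K.
Qed.
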